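(* Let $d\ge1$, let $\kappa:[-1,1]\to\mathbb{R}$ be given by $\kappa(t)=\sum_{q\ge 0}\frac{J_q^2}{q!}t^q$ with $J_q\in\mathbb{R}$, $J_q\neq0$ for infinitely many $q$, $\sum_{q\ge1}\frac{|J_q|}{(q-1)!}<\infty$, and $\kappa(1)=1$; let $\kappa_L$ denote the $L$-fold composition of $\kappa$. For each $L\ge1$ let $(T_L(x))_{x\in\mathbb{S}^d}$ be a continuous, isotropic, centered Gaussian random field on $\mathbb{S}^d$ with $\mathrm{Cov}(T_L(x),T_L(y))=\kappa_L(\langle x,y\rangle)$; let $N$ be the North Pole and $\overline{T}_L=\frac{1}{\omega_d}\int_{\mathbb{S}^d}T_L(y)\,\lambda(dy)$ the spherical average ($\lambda$ the surface measure, $\omega_d=\lambda(\mathbb{S}^d)$). Assume $\kappa'(1)=1$ and that there exist $c\in\mathbb{R}\setminus\{0\}$ and $\rho>1$ such that $1-\kappa(t)=\kappa'(1)(1-t)-c(1-t)^{\rho}+o((1-t)^{\rho})$ as $t\to1^-$. Then neither the sequence $\{(T_L(x)-T_L(N))_{x\in\mathbb{S}^d}\}_{L\ge1}$ nor the sequence $\{(T_L(x)-\overline{T}_L)_{x\in\mathbb{S}^d}\}_{L\ge1}$ satisfies a large deviation principle in $C(\mathbb{S}^d)$ with speed $v_L=L^{1/(\rho-1)}$.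
   Context: $C(\mathbb{S}^d)$ denotes the space of real continuous functions on $\mathbb{S}^d$ with the uniform topology. A sequence $\{X_L\}$ of random elements of a topological space satisfies a large deviation principle with speed $v_L\to\infty$ and rate function $I$ (lower semicontinuous, $[0,\infty]$-valued) if $\limsup_L v_L^{-1}\log P(X_L\in C)\le-\inf_C I$ for all closed $C$ and $\liminf_L v_L^{-1}\log P(X_L\in O)\ge-\inf_O I$ for all open $O$. *)

(* Defs.v *)
From HB Require Import structures.
From mathcomp Require Import all_boot all_order all_algebra.
From mathcomp Require Import all_classical all_reals all_analysis.
Set Implicit Arguments. Unset Strict Implicit. Unset Printing Implicit Defensive.
Import Order.TTheory GRing.Theory Num.Theory.
Import numFieldNormedType.Exports.
Local Open Scope classical_set_scope.
Local Open Scope ring_scope.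

Section Defs.
Variable R : realType.

Definition kappa (J : nat -> R) (t : R) : R :=
  limn (series (fun q => J q ^+ 2 / (q`!)%:R * t ^+ q)).

Definition dot n (u v : 'rV[R]_n) : R := \sum_(i < n) u ord0 i * v ord0 i.

Definition sph (d : nat) := {x : 'rV[R]_d.+1 | dot x x == 1}.

Definition northv d : 'rV[R]_d.+1 := \row_(i < d.+1) (i == ord_max)%:R.

Lemma northv_sph d : dot (northv d) (northv d) == 1.
Proof.
apply/eqP; rewrite /dot (bigD1 ord_max) //= big1 ?addr0.
  by rewrite !mxE eqxx mulr1.
by move=> i /negbTE ni; rewrite !mxE ni mul0r.
Qed.

Definition north d : sph d := exist _ (northv d) (northv_sph d).

(* radial projection x |-> x/|x| onto the sphere (North Pole at x = 0) *)
Definition sph_proj d (x : 'rV[R]_d.+1) : sph d :=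
  insubd (north d) ((Num.sqrt (dot x x))^-1 *: x).

Definition sph_continuous d (f : sph d -> R) : Prop :=
  forall (x : sph d) (e : R), 0 < e -> exists2 del : R, 0 < del &
    forall y : sph d, dot (val y - val x) (val y - val x) < del ->
      `|f y - f x| < e.

Definition Csph d : set (sph d -> R) := [set f | sph_continuous f].

Definition Copen d (O : set (sph d -> R)) : Prop :=
  O `<=` @Csph d /\
  forall f, O f -> exists2 e : R, 0 < e &
    forall g, @Csph d g -> (forall x, `|f x - g x| <= e) -> O g.

Definition Cclosed d (C : set (sph d -> R)) : Prop :=
  C `<=` @Csph d /\ @Copen d (@Csph d `\` C).

Definition rate_function d (I : (sph d -> R) -> \bar R) : Prop :=
  (forall f, (0 <= I f)%E) /\
  forall a : R, Cclosed [set f | @Csph d f /\ (I f <= a%:E)%E].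

Definition elog (x : \bar R) : \bar R :=
  match x with
  | r%:E => if (0 < r)%R then (ln r)%:E else -oo
  | +oo => +oo
  | -oo => -oo
  end%E.

Definition LDP d {d0 : measure_display} {Omega : measurableType d0}
  (P : probability Omega R) (X : nat -> Omega -> sph d -> R) (v : nat -> R)
  : Prop :=
  exists I : (sph d -> R) -> \bar R,
    rate_function I /\
    (forall C, Cclosed C ->
       (limn_esup (fun L => ((v L)^-1)%:E * elog (P [set w | C (X L w)]))
          <= - ereal_inf (I @` C))%E) /\
    (forall O, Copen O ->
       (- ereal_inf (I @` O)
          <= limn_einf (fun L => ((v L)^-1)%:E * elog (P [set w | O (X L w)])))%E).

(* T is a centered Gaussian field with covariance K: every finite linear
   combination Y = sum_i a_i T(x_i) has characteristic function
   E[exp(i Y)] = exp(-Var/2), Var = sum_{i,j} a_i a_j K(x_i,x_j). *)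
Definition centered_gaussian_field d {d0 : measure_display}
  {Omega : measurableType d0} (P : probability Omega R)
  (T : Omega -> sph d -> R) (K : sph d -> sph d -> R) : Prop :=
  (forall x, measurable_fun setT (fun w => T w x)) /\
  forall (n : nat) (xs : 'I_n -> sph d) (a : 'I_n -> R),
    let Y := fun w => \sum_(i < n) a i * T w (xs i) in
    let s2 := \sum_(i < n) \sum_(j < n) a i * a j * K (xs i) (xs j) in
    ('E_P[fun w => cos (Y w)] = (expR (- (s2 / 2)))%:E)%E /\
    ('E_P[fun w => sin (Y w)] = 0)%E.

Fixpoint iint (n : nat) (F : (nat -> R) -> \bar R) : \bar R :=
  match n with
  | 0 => F (fun _ => 0)
  | m.+1 => (\int[@lebesgue_measure R]_(t in setT)
               iint m (fun g => F (fun k => if k == m then t else g k)))%E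
  end.

Definition ball_ind n (x : 'rV[R]_n) : R := if dot x x <= 1 then 1 else 0.

(* normalized surface-measure average (1/omega_d) int_{S^d} f d(lambda),
   computed via the cone measure: lambda(A) = (d+1) Leb{r x : x in A, 0<r<=1} *)
Definition sph_avg d (f : sph d -> R) : R :=
  fine (iint d.+1 (fun g => let x := \row_(i < d.+1) g i in
                            (ball_ind x * f (sph_proj x))%:E)) /
  fine (iint d.+1 (fun g => (ball_ind (\row_(i < d.+1) g i))%:E)).

End Defs.

(* Main.v *)
Require Import Defs.
From HB Require Import structures.
From mathcomp Require Import all_boot all_order all_algebra.
From mathcomp Require Import all_classical all_reals all_analysis.
From mathcomp Require Import measurable_realfun.
From mathcomp Require Import ring lra.
Import Order.TTheory GRing.Theory Num.Theory.
Import numFieldNormedType.Exports.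
Local Open Scope classical_set_scope.
Local Open Scope ring_scope.

(* Only increments [T x - T y] matter, so both centerings are treated at once.

   Since [kappa] is convex on [0, 1] with [kappa 1 = kappa' 1 = 1], the numbers
   [u_L = 1 - kappa_L t] decrease to 0 for [0 <= t < 1], and the recursion
   [u_(L+1) = u_L - c u_L ^ rho + o(u_L ^ rho)] makes [v_L u_L] bounded away from
   0 and infinity, with [v_L (u_L(s) - u_L(t)) --> 0]: on the scale [v_L] the
   field looks like white noise.  Hence a sum of [n] increments over distinct
   points has variance of order [n / v_L], and the event that all [n] increments
   stay above a fixed threshold costs [exp (- const * n * v_L)].  A continuous
   [f] with [f x <> f y] keeps infinitely many such increments above a threshold,
   so any rate function is infinite at [f].  The upper bound for the closed set
   [|f x - f y| >= 1] would then be [-oo], whereas the single Gaussian increment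
   [T x - T y], of variance of order [1 / v_L], exceeds 1 with probability at
   least [exp (- const * v_L)].

   Gaussian tails are obtained from the characteristic function through the even
   moments: alternating Taylor remainders of cos and [exp (- x)], with Fatou's
   lemma, give the moments; Markov's inequality gives the upper tail and a
   Paley-Zygmund argument the lower one.

   Pairs with a negative scalar product are avoided: when [kappa] is odd,
   [kappa_L t --> -1] for [t < 0]. *)

(** * Convexity of kappa *)

Section kappa.
Context {R : realType}.
Implicit Types (J : nat -> R) (s t : R).

Lemma kappa_coef_ge0 J q : 0 <= J q ^+ 2 / q`!%:R.
Proof. by rewrite divr_ge0 ?sqr_ge0. Qed.

(** [limn] of a divergent sequence is the default value 0, so the value 1 at [t = 1] forces the
    coefficients to be summable. *)
Lemma kappa_coef_cvg J : kappa J 1 = 1 ->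
  cvgn (series (fun q => J q ^+ 2 / q`!%:R)).
Proof.
have -> : (fun q => J q ^+ 2 / q`!%:R) = (fun q => J q ^+ 2 / q`!%:R * 1 ^+ q).
  by apply/funext => q; rewrite expr1n mulr1.
move=> k1; apply: contrapT => ncv; move: k1; rewrite /kappa dvgP//.
by move=> /esym/eqP; rewrite oner_eq0.
Qed.

Lemma kappa_cvg J t : kappa J 1 = 1 -> 0 <= t <= 1 ->
  cvgn (series (fun q => J q ^+ 2 / q`!%:R * t ^+ q)).
Proof.
move=> /kappa_coef_cvg k1 /andP[t0 t1]; apply: series_le_cvg k1 => q.
- by rewrite mulr_ge0 ?kappa_coef_ge0 ?exprn_ge0.
- exact: kappa_coef_ge0.
- by rewrite ler_piMr ?kappa_coef_ge0// exprn_ile1.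
Qed.

Lemma kappa_ge0 J t : kappa J 1 = 1 -> 0 <= t <= 1 -> 0 <= kappa J t.
Proof.
move=> k1 /[dup] t01 /andP[t0 t1]; apply: limr_ge; first exact: kappa_cvg.
apply: nearW => n; apply: sumr_ge0 => q _.
by rewrite mulr_ge0 ?kappa_coef_ge0 ?exprn_ge0.
Qed.

Lemma kappa_le J s t : kappa J 1 = 1 -> 0 <= s -> s <= t -> t <= 1 ->
  kappa J s <= kappa J t.
Proof.
move=> k1 s0 st t1; have t0 := le_trans s0 st; have s1 := le_trans st t1.
apply: lim_series_le.
- by apply: kappa_cvg; rewrite ?s0.
- by apply: kappa_cvg; rewrite ?t0.
- by move=> q; rewrite ler_wpM2l ?kappa_coef_ge0// lerXn2r.
Qed.

(** Convexity of the monomial on [[s, 1]], where [t] is the barycentre of [s] and 1 with weights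
    [1 - t] and [t - s]; the denominator [1 - s] is cleared. *)
Lemma exprn_chord s t n : 0 <= s -> s <= t -> t <= 1 ->
  t ^+ n * (1 - s) <= (1 - t) * s ^+ n + (t - s).
Proof.
move=> s0 st t1; elim: n => [|n IH]; first by rewrite !expr0; lra.
have sn1 : s ^+ n <= 1 by rewrite exprn_ile1//; lra.
have t0 : 0 <= t by lra.
have := ler_wpM2l t0 IH; rewrite !exprS.
(* This product is exactly the slack between [t] times the induction hypothesis and the goal. *)
have : 0 <= (1 - t) * (t - s) * (1 - s ^+ n) by rewrite !mulr_ge0//; lra.
by lra.
Qed.

(** Summing [exprn_chord] against nonnegative coefficients shows that the slopes
    [(1 - kappa s) / (1 - s)] of the chords ending at 1 are nondecreasing. This is the form in which
    convexity enters the iteration. *)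
Lemma kappa_chord J s t : kappa J 1 = 1 -> 0 <= s -> s <= t -> t <= 1 ->
  (1 - kappa J s) * (1 - t) <= (1 - kappa J t) * (1 - s).
Proof.
move=> k1 s0 st t1.
suff : kappa J t * (1 - s) <= (1 - t) * kappa J s + (t - s) * kappa J 1.
  by rewrite k1; lra.
have ct : cvgn (series (fun q => J q ^+ 2 / q`!%:R * t ^+ q)).
  by apply: kappa_cvg; rewrite // t1 andbT; lra.
have cs : cvgn (series (fun q => J q ^+ 2 / q`!%:R * s ^+ q)).
  by apply: kappa_cvg; rewrite // s0; lra.
have c1 : cvgn (series (fun q => J q ^+ 2 / q`!%:R * 1 ^+ q)).
  by apply: kappa_cvg; rewrite // lexx ler01.
apply: (ler_cvg_to (cvgMr_tmp ct) (cvgD (cvgMl_tmp cs) (cvgMl_tmp c1))).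
apply: nearW => n.
rewrite -[leRHS]/(_ * series _ n + _ * series _ n) /series/= !mulr_sumr mulr_suml.
rewrite -big_split/=; apply: ler_sum => q _.
by have := ler_wpM2l (kappa_coef_ge0 J q) (exprn_chord s t q s0 st t1); rewrite expr1n; lra.
Qed.
End kappa.

(** * Decay of the iterates *)

Section powR_sub.
Context {R : realType}.
Implicit Types p c u v y : R.

Lemma powR_sub_le p y : 0 < p -> 0 <= y < 1 -> (1 - y) `^ p <= (1 + p * y)^-1.
Proof.
move=> p0 /andP[y0 y1].
have py : 0 <= p * y by rewrite mulr_ge0// ltW.
apply: (@le_trans _ _ (expR (- (p * y)))).
  rewrite /powR ifF; last by rewrite gt_eqF//; lra.
  by rewrite ler_expR -mulrN ler_pM2l// le_ln1Dx//; lra.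
by rewrite expRN lef_pV2 ?posrE ?expR_gt0 ?expR_ge1Dx//; lra.
Qed.

(** The constant 4 comes from [1 - y >= expR (- 2 y)] for [0 <= y <= 1/2], followed by
    [1 - 2 x >= (1 + 4 x)^-1] for [0 <= x <= 1/4], with [x = p y]. *)
Lemma powR_sub_ge p y : 0 < p -> 0 <= y -> y <= 2^-1 -> 4 * (p * y) <= 1 ->
  (1 + 4 * (p * y))^-1 <= (1 - y) `^ p.
Proof.
move=> p0 y0 y1 py1.
have py : 0 <= p * y by rewrite mulr_ge0// ltW.
have h1 : expR (- (2 * y)) <= 1 - y.
  rewrite expRN; apply: (@le_trans _ _ (1 + 2 * y)^-1).
    by rewrite lef_pV2 ?posrE ?expR_gt0 ?expR_ge1Dx//; lra.
  rewrite -[leLHS]mul1r ler_pdivrMr; last by lra.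
  have : 0 <= y * (2^-1 - y) by rewrite mulr_ge0//; lra.
  lra.
apply: (@le_trans _ _ (expR (- (2 * y)) `^ p)); last first.
  by rewrite ge0_ler_powR ?nnegrE ?expR_ge0//; lra.
rewrite -expRM; apply: le_trans (expR_ge1Dx _).
rewrite -[leLHS]mul1r ler_pdivrMr; last by lra.
have : 0 <= (p * y) * (1 - 4 * (p * y)) by rewrite mulr_ge0//; lra.
lra.
Qed.

(** In the coordinate [u ^ (- p)] the recursion [v = u - c u ^ (p + 1)] is close to a translation by
    [p c]. This lemma bounds the translation below; for small [u], [decay_step_ge] bounds it above
    by four times that amount. *)
Lemma decay_step_le p c u v : 0 < p -> 0 < c -> 0 < u -> 0 < v ->
  c * u `^ p < 1 -> v <= u * (1 - c * u `^ p) ->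
  (u `^ p)^-1 + p * c <= (v `^ p)^-1.
Proof.
move=> p0 c0 u0 v0 y1 vu; have z0 : 0 < u `^ p by rewrite powR_gt0.
have y0 : 0 < c * u `^ p by rewrite mulr_gt0.
have d0 : 0 < 1 + p * (c * u `^ p) by rewrite addr_gt0// mulr_gt0.
have h : v `^ p <= u `^ p / (1 + p * (c * u `^ p)).
  apply: (@le_trans _ _ (u `^ p * (1 - c * u `^ p) `^ p)).
    rewrite -powRM; [|exact: ltW|lra].
    rewrite ge0_ler_powR ?nnegrE ?(ltW p0) ?(ltW v0)//.
    exact: le_trans (ltW v0) vu.
  by rewrite ler_pM2l// powR_sub_le// (ltW y0).
have -> : (u `^ p)^-1 + p * c = (u `^ p / (1 + p * (c * u `^ p)))^-1.
  by rewrite invf_div; field; rewrite gt_eqF.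
by rewrite lef_pV2 ?posrE ?divr_gt0// powR_gt0.
Qed.

Lemma decay_step_ge p c u v : 0 < p -> 0 < c -> 0 < u ->
  c * u `^ p <= 2^-1 -> 4 * (p * (c * u `^ p)) <= 1 ->
  u * (1 - c * u `^ p) <= v ->
  (v `^ p)^-1 <= (u `^ p)^-1 + 4 * (p * c).
Proof.
move=> p0 c0 u0 y1 py1 uv; have z0 : 0 < u `^ p by rewrite powR_gt0.
have y0 : 0 < c * u `^ p by rewrite mulr_gt0.
have d0 : 0 < 1 + 4 * (p * (c * u `^ p)) by rewrite addr_gt0// !mulr_gt0.
have w0 : 0 < u * (1 - c * u `^ p) by rewrite mulr_gt0//; lra.
have v0 := lt_le_trans w0 uv.
have h : u `^ p / (1 + 4 * (p * (c * u `^ p))) <= v `^ p.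
  apply: (@le_trans _ _ (u `^ p * (1 - c * u `^ p) `^ p)).
    by rewrite ler_pM2l// powR_sub_ge// ltW.
  rewrite -powRM; [|exact: ltW|lra].
  by rewrite ge0_ler_powR ?nnegrE ?(ltW p0) ?(ltW v0) ?(ltW w0).
have -> : (u `^ p)^-1 + 4 * (p * c) = (u `^ p / (1 + 4 * (p * (c * u `^ p))))^-1.
  by rewrite invf_div; field; rewrite gt_eqF.
by rewrite lef_pV2 ?posrE ?divr_gt0// powR_gt0.
Qed.

Lemma powR_inv_bounds (a b q z n : R) : 0 < a -> 0 < b -> 0 < q -> 0 < z -> 0 < n ->
  a * n <= z^-1 <= b * n ->
  b^-1 `^ q / n `^ q <= z `^ q <= a^-1 `^ q / n `^ q.
Proof.
move=> a0 b0 q0 z0 n0 /andP[h1 h2].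
have -> : (n `^ q)^-1 = n^-1 `^ q.
  by rewrite -(powR_inv1 (ltW n0)) -powRrM mulN1r powRN.
have [a0' b0' q0' z0' n0'] := And5 (ltW a0) (ltW b0) (ltW q0) (ltW z0) (ltW n0).
rewrite -!powRM ?invr_ge0// -!invfM.
apply/andP; split; rewrite ge0_ler_powR ?nnegrE ?invr_ge0 ?mulr_ge0//.
  by rewrite -[leRHS]invrK lef_pV2 ?posrE ?invr_gt0 ?mulr_gt0.
by rewrite -[leLHS]invrK lef_pV2 ?posrE ?invr_gt0 ?mulr_gt0.
Qed.

End powR_sub.

Lemma at_left_eps {R : realType} (f : R -> R) (a l e : R) :
  f @ a^'- --> l -> 0 < e ->
  exists2 del, 0 < del & forall t, a - del < t -> t < a -> `|f t - l| < e.
Proof.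
move=> /cvgrPdist_lt fl e0; have := fl _ e0.
rewrite near_withinE => /nbhs_ballP[del /= del0 H]; exists del => // t ht ta.
rewrite distrC; apply: H => //.
by rewrite /ball/= ltr_norml; lra.
Qed.

(** * Iteration of a convex function tangent to the diagonal at 1 *)

Section iteration.
Context {R : realType} {k : R -> R} {c rho : R}.
Hypotheses (k1 : k 1 = 1) (kge0 : forall t : R, 0 <= t <= 1 -> 0 <= k t)
  (kle : forall s t : R, 0 <= s -> s <= t -> t <= 1 -> k s <= k t)
  (kchord : forall s t : R, 0 <= s -> s <= t -> t <= 1 ->
     (1 - k s) * (1 - t) <= (1 - k t) * (1 - s))
  (klim : (fun t => (k 1 - k t) / (1 - t)) @ (1 : R)^'- --> (1 : R))
  (c0 : c != 0) (rho1 : 1 < rho)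
  (kexp : (fun t => (1 - k t - (1 - t) + c * (1 - t) `^ rho) / (1 - t) `^ rho)
     @ (1 : R)^'- --> (0 : R)).

Implicit Types s t a e del : R.
Local Notation p := (rho - 1).

Let p_gt0 : 0 < p. Proof. by rewrite subr_gt0. Qed.

Lemma near_one (del t : R) : 0 < del -> t < 1 ->
  exists s, [/\ t <= s, s < 1 & 1 - del < s].
Proof.
move=> del0 t1; exists (Num.max t (1 - del / 2)).
by rewrite le_max lexx gt_max lt_max t1 !andTb; split=> //; lra.
Qed.

(** If [k t >= 1], monotonicity keeps [k >= 1] on [[t, 1[], so the difference quotients there are
    nonpositive and cannot tend to 1. *)
Lemma kern_lt1 t : 0 <= t -> t < 1 -> k t < 1.
Proof.
move=> t0 t1; rewrite ltNge; apply/negP => kt.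
have [|del del0 H] := at_left_eps _ _ _ 1 klim; first by lra.
have [s [ts s1 ds]] := near_one _ _ del0 t1.
have ks : 1 <= k s by apply: le_trans kt _; apply: kle => //; lra.
have : (k 1 - k s) / (1 - s) <= 0 by rewrite k1 ler_pdivrMr ?mul0r; lra.
by have := H s ds s1; rewrite ltr_norml; lra.
Qed.

(** The chord slopes are nondecreasing with limit 1, so none of them exceeds 1. *)
Lemma kern_ge t : 0 <= t -> t < 1 -> t <= k t.
Proof.
move=> t0 t1; rewrite leNgt; apply/negP => kt.
have e0 : 0 < (t - k t) / (1 - t) by rewrite divr_gt0; lra.
have [del del0 H] := at_left_eps _ _ _ _ klim e0.
have [s [ts s1 ds]] := near_one _ _ del0 t1.
have : (1 - k t) / (1 - t) <= (k 1 - k s) / (1 - s).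
  rewrite k1 ler_pdivrMr ?subr_gt0// mulrAC ler_pdivlMr ?subr_gt0//.
  by apply: kchord => //; exact: ltW.
have -> : (1 - k t) / (1 - t) = 1 + (t - k t) / (1 - t) by field; rewrite subr_eq0 gt_eqF.
by have := H s ds s1; rewrite ltr_norml; lra.
Qed.

(** Since [k] lies above the diagonal, [(k t - t) / (1 - t) ^ rho] is nonnegative, and its limit at
    1 is [c]. *)
Lemma expansion_coef_gt0 : 0 < c.
Proof.
rewrite lt_def c0 leNgt; apply/negP => cn.
have [|del del0 H] := at_left_eps _ _ _ (- c) kexp; first by lra.
have [s [s0 s1 ds]] := near_one _ _ del0 ltr01.
have ps : 0 < (1 - s) `^ rho by rewrite powR_gt0; lra.
have := H s ds s1; rewrite subr0 mulrDl mulfK ?gt_eqF// ltr_norml => /andP[+ _].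
have : (1 - k s - (1 - s)) / (1 - s) `^ rho <= 0.
  by rewrite ler_pdivrMr ?mul0r//; have := kern_ge s s0 s1; lra.
lra.
Qed.

(** Touching the diagonal at [t] would by convexity make [k] the identity on [[t, 1]], which
    contradicts the expansion with [c > 0]. *)
Lemma kern_gt t : 0 <= t -> t < 1 -> t < k t.
Proof.
move=> t0 t1; rewrite lt_neqAle kern_ge// andbT; apply/eqP => kt.
have [del del0 H] := at_left_eps _ _ _ _ kexp expansion_coef_gt0.
have [s [ts s1 ds]] := near_one _ _ del0 t1.
have s0 := le_trans t0 ts.
have ps : 0 < (1 - s) `^ rho by rewrite powR_gt0; lra.
have ks : k s = s.
  apply/eqP; rewrite eq_le kern_ge// andbT.
  have := kchord t s t0 ts (ltW s1); rewrite -kt mulrC ler_pM2r; lra.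
have := H s ds s1; rewrite ks subrr add0r mulfK ?gt_eqF// subr0 ltr_norml; lra.
Qed.

Lemma kern_expansion : exists2 del, 0 < del <= 1 & forall t, 1 - del < t -> t < 1 ->
  c / 2 * (1 - t) `^ rho <= k t - t <= 2 * c * (1 - t) `^ rho.
Proof.
have cp := expansion_coef_gt0.
have [|del del0 H] := at_left_eps _ _ _ (c / 2) kexp; first by lra.
exists (Num.min del 1); first by rewrite lt_min del0 ltr01 ge_min lexx orbT.
move=> t; rewrite ltrBlDr -ltrBlDl lt_min => /andP[h1 h2] t1.
have ps : 0 < (1 - t) `^ rho by rewrite powR_gt0; lra.
have := H t; rewrite subr0 mulrDl mulfK ?gt_eqF// ltr_norml => /(_ _ t1).
have -> : (1 - k t - (1 - t)) / (1 - t) `^ rho = - ((k t - t) / (1 - t) `^ rho).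
  by rewrite -mulNr; congr (_ / _); ring.
move=> /(_ _)/andP[|]; first by lra.
set x := (k t - t) / _ => h3 h4.
have -> : k t - t = x * (1 - t) `^ rho by rewrite /x mulfVK// gt_eqF.
by rewrite !ler_pM2r//; lra.
Qed.

Lemma iter_kern_itv n t : 0 <= t -> t < 1 -> 0 <= iter n k t < 1.
Proof.
move=> t0 t1; elim: n => [|n /= /andP[h0 h1]]; first by rewrite /= t0.
by rewrite kge0 ?h0 ?ltW//= kern_lt1.
Qed.

Lemma iter_kern_one n : iter n k 1 = 1.
Proof. by elim: n => //= n ->. Qed.

Lemma iter_kern_le n s t : 0 <= s -> s <= t -> t < 1 -> iter n k s <= iter n k t.
Proof.
move=> s0 st t1; elim: n => //= n IH.
have /andP[h0 _] := iter_kern_itv n s s0 (le_lt_trans st t1).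
have /andP[_ h1] := iter_kern_itv n t (le_trans s0 st) t1.
by apply: kle => //; exact: ltW.
Qed.

Lemma iter_kern_homo m n t : 0 <= t -> t < 1 -> (m <= n)%N ->
  iter m k t <= iter n k t.
Proof.
move=> t0 t1 /subnKC <-; elim: (n - m)%N => [|i IH]; first by rewrite addn0.
rewrite addnS /=; apply: le_trans IH _.
by have /andP[? ?] := iter_kern_itv (m + i) t t0 t1; exact: kern_ge.
Qed.

(** By convexity the gain [k x - x] on [[0, a]] is at least [h = k a - a > 0], so an orbit that
    stayed below [a] would grow linearly. *)
Lemma iter_kern_approach a t : 0 <= t -> t < 1 -> a < 1 ->
  exists n, forall m, (n <= m)%N -> a <= iter m k t.
Proof.
move=> t0 t1 a1.
suff [n hn] : exists n, a <= iter n k t.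
  by exists n => m nm; apply: le_trans hn _; exact: iter_kern_homo.
apply: contrapT => /forallNP H.
have {}H n : iter n k t < a by rewrite ltNge; apply/negP.
have a0 : 0 <= a by apply: le_trans t0 _; apply: ltW; exact: (H 0).
pose h := k a - a.
have h0 : 0 < h by rewrite subr_gt0 kern_gt.
have step x : 0 <= x -> x <= a -> x + h <= k x.
  move=> x0 xa; have ch := kchord x a x0 xa (ltW a1).
  have : (1 - k x) * (1 - a) <= (1 - x - h) * (1 - a).
    apply: (le_trans ch); rewrite /h.
    have : 0 <= (a - x) * (k a - a) by rewrite mulr_ge0 ?subr_ge0 ?kern_ge.
    lra.
  by rewrite ler_pM2r ?subr_gt0//; lra.
have grow n : n%:R * h <= iter n k t.
  elim: n => [|n IH]; first by rewrite mul0r.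
  have /andP[i0 i1] := iter_kern_itv n t t0 t1.
  rewrite iterS; apply: le_trans (step _ i0 (ltW (H n))).
  by rewrite -natr1 mulrDl mul1r lerD2r.
have := truncnS_gt (a / h); rewrite ltr_pdivrMr// => ah.
by have := lt_le_trans (lt_trans (H (Num.truncn (a / h)).+1) ah) (grow _); rewrite ltxx.
Qed.

(** Let [u] be the distance of the orbit to 1 and [z = u ^ p]. Once [u] is small, each step raises
    [z^-1] by an amount between [p c / 2] and [8 p c], so [z^-1] grows linearly and [u] decays like
    the power [- 1 / p] of time. *)
Lemma orbit_bounds t : 0 <= t -> t < 1 ->
  exists b B N, [/\ 0 < b, 0 < B & forall L, (N <= L)%N ->
    b / L.+1%:R `^ p^-1 <= 1 - iter L.+1 k t <= B / L.+1%:R `^ p^-1].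
Proof.
move=> t0 t1; have cp := expansion_coef_gt0; have p0 := p_gt0.
have [del /andP[del0 del1] Hdel] := kern_expansion.
(* These are the two smallness conditions of [decay_step_ge] for the coefficient [2 c]. *)
pose z0 := Num.min (1 / (4 * c)) (1 / (8 * (p * c))).
have z00 : 0 < z0 by rewrite lt_min !divr_gt0 ?mulr_gt0.
(* The bound [u <= e] gives both [u < del], where the expansion applies, and [z <= z0]. *)
pose e := Num.min (del / 2) (z0 `^ p^-1).
have e0 : 0 < e by rewrite lt_min powR_gt0// divr_gt0.
have [|N HN] := iter_kern_approach (1 - e) t t0 t1; first by lra.
pose u n := 1 - iter (N + n) k t.
pose z n := u n `^ p.
have u0 n : 0 < u n by rewrite subr_gt0; have /andP[] := iter_kern_itv (N + n) t t0 t1.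
have z0n n : 0 < z n by rewrite powR_gt0.
have ue n : u n <= e by have := HN (N + n)%N (leq_addr _ _); rewrite /u; lra.
have zb n : z n <= z0.
  have -> : z0 = (z0 `^ p^-1) `^ p by rewrite -powRrM mulVf ?powRr1 ?gt_eqF// ltW.
  rewrite ge0_ler_powR ?nnegrE ?powR_ge0 ?(ltW p0) ?(ltW (u0 n))//.
  by rewrite (le_trans (ue n))// /e ge_min lexx orbT.
have step n : u n * (1 - 2 * c * z n) <= u n.+1 <= u n * (1 - c / 2 * z n).
  have := Hdel (iter (N + n) k t); rewrite -/(u n).
  have -> : u n `^ rho = u n * z n.
    by rewrite /z mulr_powRB1// ?ltW//; lra.
  have : e < del by rewrite /e gt_min; apply/orP; left; lra.
  have -> : u n.+1 = 1 - k (iter (N + n) k t) by rewrite /u addnS.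
  have -> : iter (N + n) k t = 1 - u n by rewrite /u; ring.
  move=> ed H; have /H{H} H1 : 1 - del < 1 - u n by have := ue n; lra.
  have /H1 : 1 - u n < 1 by have := u0 n; lra.
  lra.
have zc n : 2 * c * z n <= 2^-1.
  have : z n <= 1 / (4 * c) by rewrite (le_trans (zb n))// /z0 ge_min lexx.
  by rewrite ler_pdivlMr ?mulr_gt0//; lra.
have zpc n : 4 * (p * (2 * c * z n)) <= 1.
  have : z n <= 1 / (8 * (p * c)) by rewrite (le_trans (zb n))// /z0 ge_min lexx orbT.
  by rewrite ler_pdivlMr ?mulr_gt0//; lra.
have cz n : 0 < c * z n by rewrite mulr_gt0.
have w_lo n : (z n)^-1 + p * c / 2 <= (z n.+1)^-1.
  have /andP[_ h] := step n.
  rewrite -mulrA; apply: decay_step_le => //; first by rewrite divr_gt0.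
  by rewrite -/(z n); have := cz n; have := zc n; lra.
have w_hi n : (z n.+1)^-1 <= (z n)^-1 + 8 * (p * c).
  have /andP[h _] := step n.
  have -> : 8 * (p * c) = 4 * (p * (2 * c)) by ring.
  by apply: (@decay_step_ge _ p (2 * c)); rewrite ?mulr_gt0 ?zc ?zpc.
have W_lo n : n%:R * (p * c / 2) <= (z n)^-1.
  elim: n => [|n IH]; first by rewrite mul0r invr_ge0 ltW.
  by apply: le_trans (w_lo n); rewrite -natr1 mulrDl mul1r lerD2r.
have W_hi n : (z n)^-1 <= (z 0%N)^-1 + n%:R * (8 * (p * c)).
  elim: n => [|n IH]; first by rewrite mul0r addr0.
  by have := w_hi n; rewrite -natr1; lra.
pose A := (z 0%N)^-1 + 8 * (p * c).
have pc : 0 < p * c by rewrite mulr_gt0.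
have A0 : 0 < A by rewrite /A addr_gt0 ?invr_gt0// mulr_gt0.
(* The orbit is tracked only from time [N]. For [L >= 2 N] the elapsed time [L.+1 - N] is at least
   half of [L.+1], which turns [p c / 2] into [p c / 4]. *)
exists (A^-1 `^ p^-1), ((p * c / 4)^-1 `^ p^-1), (N.*2).
split; [by rewrite powR_gt0 ?invr_gt0|by rewrite powR_gt0 ?invr_gt0 ?divr_gt0|] => L NL.
have NL1 : (N <= L.+1)%N by rewrite (leq_trans _ (leqW NL))// -addnn leq_addr.
have -> : 1 - iter L.+1 k t = u (L.+1 - N)%N by rewrite /u subnKC.
set n := (L.+1 - N)%N.
have n1 : n%:R <= L.+1%:R :> R by rewrite ler_nat leq_subr.
have n2 : L.+1%:R / 2 <= n%:R :> R.
  rewrite ler_pdivrMr// -natrM ler_nat /n.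
  rewrite muln2 doubleB leq_subRL; last by rewrite leq_double.
  by rewrite -[leqRHS]addnn leq_add2r leqW.
have -> : u n = (z n) `^ p^-1.
  by rewrite /z -powRrM mulfV ?powRr1 ?gt_eqF// ltW.
apply: powR_inv_bounds; rewrite ?invr_gt0 ?divr_gt0//; apply/andP; split.
  by apply: le_trans (W_lo n); have := ler_wpM2r (ltW pc) n2; lra.
apply: le_trans (W_hi n) _; rewrite /A [leRHS]mulrDl lerD//.
  by rewrite ler_peMr ?invr_ge0 ?(ltW (z0n _))// ler1n.
by rewrite mulrC ler_pM2l// mulr_gt0.
Qed.

(** For [s <= t] the orbit of [s] passes [t] after some [m] steps, so the orbit of [t] stays between
    the orbit of [s] and its shift by [m]. With [u] the distance from the orbit of [s] to 1, these
    [m] extra steps cost at most [2 c m u ^ rho], which is [o(u)]. *)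
Lemma orbit_diff s t e : 0 <= s -> s < 1 -> 0 <= t -> t < 1 -> 0 < e ->
  exists N, forall L, (N <= L)%N ->
    `|iter L.+1 k s - iter L.+1 k t| <= e / L.+1%:R `^ p^-1.
Proof.
wlog st : s t / s <= t.
  move=> H s0 s1 t0 t1 e0; have [st|/ltW ts] := leP s t; first exact: H.
  by have [N HN] := H t s ts t0 t1 s0 s1 e0; exists N => L /HN; rewrite distrC.
move=> s0 s1 t0 t1 e0; have cp := expansion_coef_gt0; have p0 := p_gt0.
have [m /(_ m (leqnn _)) tm] := iter_kern_approach t s s0 s1 t1.
have [del /andP[del0 del1] Hdel] := kern_expansion.
have [b [B [N0 [b0 B0 HB]]]] := orbit_bounds s s0 s1.
(* With [V = L.+1 ^ (1 / p)], the bounds [u <= B / V] and [u ^ p <= e / M] give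
   [2 c m u ^ rho <= e / V]; the summand 1 keeps [M] positive when [m = 0]. *)
pose M := 2 * c * m%:R * B + 1.
have M0 : 0 < M by rewrite /M ltr_wpDl// !mulr_ge0// ltW.
pose eta := Num.min (del / 2) ((e / M) `^ p^-1).
have eta0 : 0 < eta by rewrite lt_min powR_gt0 divr_gt0.
have [|N1 HN1] := iter_kern_approach (1 - eta) s s0 s1; first by lra.
exists (maxn N0 N1) => L; rewrite geq_max => /andP[NL0 NL1].
set u := 1 - iter L.+1 k s.
have u0 : 0 < u by rewrite subr_gt0; have /andP[] := iter_kern_itv L.+1 s s0 s1.
have ueta : u <= eta by have := HN1 L.+1 (leqW NL1); rewrite /u; lra.
have udel : u < del.
  by apply: le_lt_trans ueta _; rewrite /eta gt_min; apply/orP; left; lra.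
have inc j : iter (L.+1 + j) k s - iter L.+1 k s <= j%:R * (2 * c * u `^ rho).
  elim: j => [|j IH]; first by rewrite addn0 subrr mul0r.
  have /andP[x0 x1] := iter_kern_itv (L.+1 + j) s s0 s1.
  have xu : iter L.+1 k s <= iter (L.+1 + j) k s.
    by apply: iter_kern_homo => //; exact: leq_addr.
  have xd : 1 - del < iter (L.+1 + j) k s.
    by apply: lt_le_trans xu; rewrite /u in udel; lra.
  have /andP[_ hx] := Hdel _ xd x1.
  have : (1 - iter (L.+1 + j) k s) `^ rho <= u `^ rho.
    by rewrite ge0_ler_powR ?nnegrE//; rewrite /u; lra.
  move=> /(ler_wpM2l (ltW cp)) hc.
  rewrite addnS iterS -natr1 mulrDl mul1r; lra.
have it : iter L.+1 k t <= iter (L.+1 + m) k s.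
  by rewrite iterD; apply: iter_kern_le => //; have /andP[] := iter_kern_itv m s s0 s1.
have is_ := iter_kern_le L.+1 s t s0 st t1.
rewrite ler0_norm ?subr_le0// opprB.
apply: (@le_trans _ _ (m%:R * (2 * c * u `^ rho))); first by have := inc m; lra.
have /andP[_ uB] := HB L NL0; rewrite -/u in uB.
have -> : u `^ rho = u * u `^ p by rewrite mulr_powRB1// ?ltW//; lra.
have up : u `^ p <= e / M.
  have -> : e / M = ((e / M) `^ p^-1) `^ p.
    by rewrite -powRrM mulVf ?powRr1 ?gt_eqF// divr_ge0 ?ltW.
  rewrite ge0_ler_powR ?nnegrE ?powR_ge0 ?(ltW p0) ?(ltW u0)//.
  by rewrite (le_trans ueta)// /eta ge_min lexx orbT.
set V := L.+1%:R `^ p^-1 in uB *.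
have V0 : 0 < V by rewrite powR_gt0.
have h : u * u `^ p <= B / V * (e / M).
  by apply: ler_pM => //; rewrite ?powR_ge0 ?ltW.
have mc : 0 <= m%:R * (2 * c) by rewrite mulr_ge0 ?mulr_ge0// ltW.
rewrite mulrA; apply: le_trans (ler_wpM2l mc h) _.
have -> : m%:R * (2 * c) * (B / V * (e / M)) = (M - 1) / M * (e / V).
  by rewrite /M; field; rewrite !gt_eqF.
rewrite ler_piMl ?divr_ge0 ?ltW// ltr_pdivrMr ?mul1r//; lra.
Qed.

End iteration.

(** * Gaussian moments and tails *)

Section limn_bounds.
Context {R : realType}.
Implicit Types (u : (\bar R)^nat) (M : \bar R).

Lemma limn_einf_le u M N : (forall n, (N <= n)%N -> (u n <= M)%E) ->
  (limn_einf u <= M)%E.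
Proof.
move=> uM; rewrite limn_einf_lim; apply: lime_le; first exact: is_cvg_einfs.
exists N => // n /= Nn; apply: le_trans (uM n Nn).
by apply: ereal_inf_lbound; exists n => /=.
Qed.

Lemma limn_esup_ge u M N : (forall n, (N <= n)%N -> (M <= u n)%E) ->
  (M <= limn_esup u)%E.
Proof.
move=> uM; rewrite limn_esup_lim; apply: lime_ge; first exact: is_cvg_esups.
exists N => // n /= Nn; apply: le_trans (uM n Nn) _.
by apply: ereal_sup_ubound; exists n => /=.
Qed.

End limn_bounds.

(** * Alternating Taylor remainders of the cosine and the exponential *)

Section taylor_remainders.
Context {R : realType}.
Implicit Types (f g : R -> R) (x : R).

Lemma derive_ge0_ge0 f g : (forall x, is_derive x 1 f (g x)) -> f 0 = 0 ->
  (forall x, 0 <= x -> 0 <= g x) -> forall x, 0 <= x -> 0 <= f x.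
Proof.
move=> fg f0 g0 x x0; rewrite -f0.
have fd y : derivable f y 1 by have := fg y; case.
apply: (@ger0_derive1_ndecr _ f 0 x) => // [y|].
  rewrite in_itv/= => /andP[/ltW y0 _].
  by rewrite derive1E derive_val g0.
apply: continuous_subspaceT => y.
exact/differentiable_continuous/derivable1_diffP.
Qed.

Lemma is_derive_exprfact n x :
  is_derive x 1 (fun y : R => y ^+ n.+1 / n.+1`!%:R) (x ^+ n / n`!%:R).
Proof.
have -> : (fun y : R => y ^+ n.+1 / n.+1`!%:R) = (n.+1`!%:R^-1 \*: (@id R ^+ n.+1)).
  apply/funext => y; rewrite /= mulrC.
  by rewrite exprfctE.
apply: is_derive_eq.
rewrite /GRing.scale/= mulr1 factS natrM; field.
by rewrite nat1r !pnatr_eq0 -lt0n fact_gt0.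
Qed.

(* [cos_rem n] is, up to sign, the Taylor remainder of order [n] of cos (n even)
   or sin (n odd); [exp_rem n] is that of [expR (- x)]. *)
Fixpoint cos_rem n x : R :=
  match n with
  | 0 => 1 - cos x
  | 1 => x - sin x
  | m.+2 => x ^+ m.+2 / m.+2`!%:R - cos_rem m x
  end.

Fixpoint exp_rem n x : R :=
  match n with
  | 0 => 1 - expR (- x)
  | m.+1 => x ^+ m.+1 / m.+1`!%:R - exp_rem m x
  end.

Lemma cos_remSS n x : cos_rem n.+2 x = x ^+ n.+2 / n.+2`!%:R - cos_rem n x.
Proof. by []. Qed.

Lemma exp_remS n x : exp_rem n.+1 x = x ^+ n.+1 / n.+1`!%:R - exp_rem n x.
Proof. by []. Qed.

Lemma is_derive_cos_rem n x : is_derive x 1 (cos_rem n.+1) (cos_rem n x).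
Proof.
suff [] : is_derive x 1 (cos_rem n.+1) (cos_rem n x) /\
          is_derive x 1 (cos_rem n.+2) (cos_rem n.+1 x) by [].
elim: n => [|n [IH1 IH2]]; last first.
  by split=> //; exact: (is_deriveB (is_derive_exprfact n.+2 x) IH1).
split; first exact: is_deriveB.
have -> : cos_rem 1 x = x ^+ 1 / 1`!%:R - (0 - (- sin x)).
  by rewrite /= expr1 divr1; ring.
have h : is_derive x 1 (fun y => 1 - cos y) (0 - (- sin x)).
  exact: (is_deriveB (is_derive_cst _ _ _)).
exact: (is_deriveB (is_derive_exprfact _ _) h).
Qed.

Lemma is_derive_exp_rem n x : is_derive x 1 (exp_rem n.+1) (exp_rem n x).
Proof.
have h0 : is_derive x 1 (exp_rem 0) (expR (- x)).
  have hN : is_derive x 1 (fun y : R => expR (- y)) (- expR (- x)).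
    have := is_derive1_comp (is_derive_expR (- x)) (is_deriveNid x 1).
    by rewrite mulrN1.
  have := is_deriveB (is_derive_cst (1 : R) x 1) hN.
  by rewrite sub0r opprK.
elim: n => [|n IH]; last by exact: (is_deriveB (is_derive_exprfact _ _) IH).
have := is_deriveB (is_derive_exprfact 0 x) h0.
by rewrite expr0 fact0 divr1.
Qed.

Lemma cos_rem0 n : cos_rem n 0 = 0.
Proof.
suff [] : cos_rem n 0 = 0 /\ cos_rem n.+1 0 = 0 by [].
elim: n => [|n [h1 h2]]; first by rewrite /= cos0 sin0 !subrr.
by split => //; rewrite cos_remSS h1 expr0n mul0r subrr.
Qed.

Lemma exp_rem0 n : exp_rem n 0 = 0.
Proof.
elim: n => [|n IH]; first by rewrite /= oppr0 expR0 subrr.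
by rewrite exp_remS IH expr0n mul0r subrr.
Qed.

(** Each remainder is the derivative of the next one, which vanishes at 0, so nonnegativity on the
    half-line propagates from one order to the next. *)
Lemma cos_rem_ge0_pos n x : 0 <= x -> 0 <= cos_rem n x.
Proof.
elim: n x => [x _|n IH]; first by rewrite subr_ge0 cos_le1.
by apply: derive_ge0_ge0 (is_derive_cos_rem n) (cos_rem0 _) _.
Qed.

Lemma exp_rem_ge0 n x : 0 <= x -> 0 <= exp_rem n x.
Proof.
elim: n x => [x x0|n IH]; first by rewrite subr_ge0 expR_le1 oppr_le0.
by apply: derive_ge0_ge0 (is_derive_exp_rem n) (exp_rem0 _) _.
Qed.

Lemma exp_rem_le n x : 0 <= x -> exp_rem n x <= x ^+ n.+1 / n.+1`!%:R.
Proof. by move=> x0; rewrite -subr_ge0 -exp_remS exp_rem_ge0. Qed.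

Lemma exp_rem_ge n x : 0 <= x ->
  x ^+ n.+1 / n.+1`!%:R - x ^+ n.+2 / n.+2`!%:R <= exp_rem n x.
Proof. by move=> x0; have := exp_rem_le n.+1 x x0; rewrite exp_remS; lra. Qed.

Lemma cos_rem_even n x : cos_rem n.*2 (- x) = cos_rem n.*2 x.
Proof.
elim: n => [|n IH]; first by rewrite /= cosN.
by rewrite doubleS !cos_remSS IH -doubleS -mul2n !exprM sqrrN.
Qed.

Lemma cos_rem_ge0 n x : 0 <= cos_rem n.*2 x.
Proof.
have [x0|/ltW x0] := leP 0 x; first exact: cos_rem_ge0_pos.
by rewrite -cos_rem_even cos_rem_ge0_pos// oppr_ge0.
Qed.

Lemma cos_rem_le n x : cos_rem n.*2 x <= x ^+ n.+1.*2 / n.+1.*2`!%:R.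
Proof. by rewrite -subr_ge0 doubleS -cos_remSS -doubleS cos_rem_ge0. Qed.

Lemma cos_rem_ge n x :
  x ^+ n.+1.*2 / n.+1.*2`!%:R - x ^+ n.+2.*2 / n.+2.*2`!%:R <= cos_rem n.*2 x.
Proof. by have := cos_rem_le n.+1 x; rewrite {1}doubleS cos_remSS -doubleS; lra. Qed.

Lemma continuous_cos_rem n : continuous (cos_rem n.*2).
Proof.
move=> x; case: n => [|n]; last first.
  rewrite doubleS; apply/differentiable_continuous/derivable1_diffP.
  by have := is_derive_cos_rem n.*2.+1 x; case.
by apply: cvgB; [exact: cvg_cst|exact: continuous_cos].
Qed.

End taylor_remainders.

Lemma measurable_continuous_comp {R : realType} {d0 : measure_display}
  {Omega : measurableType d0} (f : R -> R) (Y : Omega -> R) :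
  continuous f -> measurable_fun setT Y -> measurable_fun setT (fun w => f (Y w)).
Proof. by move=> cf mY; apply: measurableT_comp mY; exact: continuous_measurable_fun. Qed.

(** * Even moments from the characteristic function *)

Section gaussian_moments.
Context {R : realType} {d0 : measure_display} {Omega : measurableType d0}.
Context {P : probability Omega R} {Y : Omega -> R} {s : R}.
Hypotheses (mY : measurable_fun setT Y)
  (charY : forall a, (\int[P]_w (cos (a * Y w))%:E = (expR (- (a ^+ 2 * s / 2)))%:E)%E).

(** The moment of order [2 k] of the centered normal law of variance [s], usually written
    [(2 k - 1)!! s ^ k]. *)
Definition gauss_moment (s : R) k : R := k.*2`!%:R / k`!%:R * (s / 2) ^+ k.

Lemma prob_integral1 : (\int[P]_w (1 : R)%:E = 1)%E.
Proof. by have := expectation_cst P 1; rewrite unlock. Qed.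

Lemma scaled_measurable a : measurable_fun setT (fun w => a * Y w).
Proof. exact: measurable_funM. Qed.

Lemma cos_rem_measurable k a : measurable_fun setT (fun w => cos_rem k.*2 (a * Y w)).
Proof.
apply: (measurable_continuous_comp (cos_rem k.*2)); first exact: continuous_cos_rem.
exact: scaled_measurable.
Qed.

Lemma cos_integrable a : P.-integrable setT (EFin \o (fun w => cos (a * Y w))).
Proof.
apply: (@le_integrable _ _ _ _ _ measurableT _ (EFin \o cst 1)).
- apply/measurable_EFinP; apply: (measurable_continuous_comp cos).
    exact: continuous_cos.
  exact: scaled_measurable.
- by move=> w _ /=; rewrite lee_fin normr1 ler_norml cos_geN1 cos_le1.
- exact: finite_measure_integrable_cst.
Qed.

Lemma gauss_var_ge0 : 0 <= s.
Proof.
have : (\int[P]_w (cos (1 * Y w))%:E <= \int[P]_w (cst 1%:E w))%E.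
  apply: le_integral => //; first exact: cos_integrable.
    exact: finite_measure_integrable_cst.
  by move=> w _; rewrite lee_fin cos_le1.
rewrite charY prob_integral1 lee_fin.
by rewrite expR_le1; lra.
Qed.

Lemma gauss_moment_ge0 k : 0 <= gauss_moment s k.
Proof. by rewrite /gauss_moment mulr_ge0 ?exprn_ge0 ?divr_ge0 ?gauss_var_ge0. Qed.

(** Up to the common sign, the Taylor term of order [2 k] of [cos (a Y)] has as expectation the
    Taylor term of order [k] of [expR (- (a ^ 2 s / 2))]. *)
Lemma gauss_moment_scale k a :
  a ^+ k.*2 / k.*2`!%:R * gauss_moment s k = (a ^+ 2 * s / 2) ^+ k / k`!%:R.
Proof.
rewrite -[in RHS]mulrA [in RHS]exprMn -exprM mul2n /gauss_moment; field.
by rewrite !pnatr_eq0 -!lt0n !fact_gt0.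
Qed.

(** The remainder at [h y], with [h = 1 / (n + 1)], is divided by [h ^ (2 k + 2) / (2 k + 2)!]. The
    next Taylor term bounds the error by [K h ^ 2 <= K h]. *)
Lemma cvg_cos_rem k (y : R) :
  (fun n : nat => k.+1.*2`!%:R * n.+1%:R ^+ k.+1.*2 * cos_rem k.*2 (n.+1%:R^-1 * y))
    @ \oo --> y ^+ k.+1.*2.
Proof.
set c := k.+1.*2`!%:R; have c0 : 0 < c :> R by rewrite ltr0n fact_gt0.
pose K := c / k.+2.*2`!%:R * y ^+ k.+2.*2.
have bnd n : y ^+ k.+1.*2 - K * n.+1%:R^-1 <=
    c * n.+1%:R ^+ k.+1.*2 * cos_rem k.*2 (n.+1%:R^-1 * y) <= y ^+ k.+1.*2.
  set N : R := n.+1%:R; have N0 : 0 < N by rewrite ltr0n.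
  have cN : 0 < c * N ^+ k.+1.*2 by rewrite mulr_gt0 ?exprn_gt0.
  have y0 : 0 <= y ^+ k.+2.*2 by rewrite -mul2n exprM exprn_ge0 ?sqr_ge0.
  apply/andP; split; last first.
    have := ler_wpM2l (ltW cN) (cos_rem_le k (N^-1 * y)).
    move/le_trans; apply; rewrite le_eqVlt; apply/orP; left; apply/eqP.
    have E (M m z : R) : M != 0 -> m != 0 -> m * M * (M^-1 * z / m) = z.
      by move=> *; field; apply/andP.
    by rewrite exprMn exprVn E ?gt_eqF ?exprn_gt0.
  have := ler_wpM2l (ltW cN) (cos_rem_ge k (N^-1 * y)).
  apply: le_trans.
  have -> : c * N ^+ k.+1.*2 * ((N^-1 * y) ^+ k.+1.*2 / k.+1.*2`!%:R -
      (N^-1 * y) ^+ k.+2.*2 / k.+2.*2`!%:R) = y ^+ k.+1.*2 - K * N ^- 2.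
    have NE : N^-1 ^+ k.+2.*2 = N ^- 2 * N ^- k.+1.*2.
      by rewrite doubleS -addn2 exprD !exprVn mulrC.
    have E (M m m' z z' x : R) : M != 0 -> m != 0 -> m' != 0 ->
      m * M * (M^-1 * z / m - x * M^-1 * z' / m') = z - m / m' * z' * x.
      by move=> M0 m0 m1; field; rewrite M0 m0 m1.
    by rewrite !exprMn NE exprVn E// gt_eqF ?exprn_gt0// ltr0n fact_gt0.
  have K0 : 0 <= K by rewrite /K mulr_ge0 // divr_ge0.
  rewrite lerD2l lerN2 ler_wpM2l//.
  by rewrite lef_pV2 ?posrE ?exprn_gt0// expr2 ler_peMl ?(ltW N0)// ler1n.
apply: (@squeeze_cvgr _ _ _ _ (fun n => y ^+ k.+1.*2 - K / n.+1%:R)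
  (fun=> y ^+ k.+1.*2)); [exact: nearW bnd| |exact: cvg_cst].
rewrite -[X in _ --> X]subr0 -[X in _ - X](mulr0 K).
by apply: cvgB; [exact: cvg_cst|apply: cvgMl_tmp; exact: cvg_harmonic].
Qed.

(** Fatou's lemma for the rescaled remainders of [cvg_cos_rem], whose expectations are at most the
    claimed moment by [exp_rem_le]. *)
Lemma moment_le k :
  (forall a, (\int[P]_w (cos_rem k.*2 (a * Y w))%:E = (exp_rem k (a ^+ 2 * s / 2))%:E)%E) ->
  (\int[P]_w (Y w ^+ k.+1.*2)%:E <= (gauss_moment s k.+1)%:E)%E.
Proof.
move=> remE; pose f n w :=
  (k.+1.*2`!%:R * n.+1%:R ^+ k.+1.*2 * cos_rem k.*2 (n.+1%:R^-1 * Y w))%:E.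
have f0 n w : (0 <= f n w)%E
  by rewrite lee_fin mulr_ge0 ?cos_rem_ge0// mulr_ge0 ?exprn_ge0.
have mf n : measurable_fun setT (f n).
  apply/measurable_EFinP; apply: measurable_funM => //.
  exact: cos_rem_measurable.
have -> : (\int[P]_w (Y w ^+ k.+1.*2)%:E = \int[P]_w limn_einf (f^~ w))%E.
  apply: eq_integral => w _; apply/esym.
  apply: (cvg_limn_einf_sup _).1; apply: cvg_EFin; first exact: nearW.
  exact: cvg_cos_rem.
apply: le_trans (fatou P measurableT mf _) _ => //.
apply: (limn_einf_le _ _ 0) => n _.
rewrite /f; under eq_integral do rewrite EFinM.
rewrite ge0_integralZl//; first last.
- by move=> w _; rewrite lee_fin cos_rem_ge0.
- exact/measurable_EFinP/cos_rem_measurable.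
rewrite remE -EFinM lee_fin; set N : R := n.+1%:R.
have N0 : 0 < N by rewrite ltr0n.
have x0 : 0 <= N^-1 ^+ 2 * s / 2 by rewrite !mulr_ge0 ?gauss_var_ge0 ?exprn_ge0 ?invr_ge0 ?(ltW N0).
apply: le_trans (ler_wpM2l _ (exp_rem_le k _ x0)) _; first by rewrite mulr_ge0 ?exprn_ge0 ?(ltW N0).
rewrite -gauss_moment_scale exprVn le_eqVlt; apply/orP; left; apply/eqP; field.
by rewrite (gt_eqF (exprn_gt0 _ N0)) andbT pnatr_eq0 -lt0n fact_gt0.
Qed.

(** The leading term dominates the remainder pointwise, so the inequality is integrated for fixed
    [a]; by [exp_rem_ge] it becomes sharp as [a] tends to 0. The bound [moment_le] supplies
    finiteness. *)
Lemma moment_ge k :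
  (forall a, (\int[P]_w (cos_rem k.*2 (a * Y w))%:E = (exp_rem k (a ^+ 2 * s / 2))%:E)%E) ->
  ((gauss_moment s k.+1)%:E <= \int[P]_w (Y w ^+ k.+1.*2)%:E)%E.
Proof.
move=> remE; have hle := moment_le k remE.
have Y0 w : 0 <= Y w ^+ k.+1.*2 by rewrite -mul2n exprM exprn_ge0 ?sqr_ge0.
have mYk : measurable_fun setT (fun w => (Y w ^+ k.+1.*2)%:E).
  by apply/measurable_EFinP; exact: measurable_funX.
have I0 : (0 <= \int[P]_w (Y w ^+ k.+1.*2)%:E)%E.
  by apply: integral_ge0 => w _; rewrite lee_fin.
have Ifin : (\int[P]_w (Y w ^+ k.+1.*2)%:E)%E \is a fin_num.
  by rewrite ge0_fin_numE//; apply: le_lt_trans hle _; rewrite ltry.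
rewrite -(fineK Ifin) lee_fin; set I := fine _.
have s0 := gauss_var_ge0; have m0 := gauss_moment_ge0 k.+1.
have key a : 0 < a -> gauss_moment s k.+1 * (1 - a ^+ 2 * s / 2) <= I.
  move=> a0; have ak : 0 < a ^+ k.+1.*2 / k.+1.*2`!%:R.
    by rewrite divr_gt0 ?exprn_gt0// ltr0n fact_gt0.
  have : ((exp_rem k (a ^+ 2 * s / 2))%:E <= (a ^+ k.+1.*2 / k.+1.*2`!%:R * I)%:E)%E.
    rewrite -remE EFinM /I fineK// -ge0_integralZl//; last 2 first.
    - by move=> w _; rewrite lee_fin.
    - by rewrite lee_fin ltW.
    apply: ge0_le_integral => //.
    - by move=> w _; rewrite lee_fin cos_rem_ge0.
    - exact/measurable_EFinP/cos_rem_measurable.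
    - apply/measurable_EFinP; apply: measurable_funM => //.
      exact: measurable_funX.
    - move=> w _; rewrite -EFinM lee_fin.
      by apply: le_trans (cos_rem_le _ _) _; rewrite exprMn mulrAC.
  have x0 : 0 <= a ^+ 2 * s / 2 by rewrite !mulr_ge0 ?exprn_ge0 ?(ltW a0).
  rewrite lee_fin => h; have := le_trans (exp_rem_ge k _ x0) h.
  set x := a ^+ 2 * s / 2; rewrite -/x in x0 *.
  have -> : x ^+ k.+1 / k.+1`!%:R - x ^+ k.+2 / k.+2`!%:R =
      x ^+ k.+1 / k.+1`!%:R * (1 - x / k.+2%:R).
    by rewrite [k.+2`!]factS natrM [x ^+ k.+2]exprS invfM; ring.
  rewrite -gauss_moment_scale -[leLHS]mulrA ler_pM2l// => h2; apply: le_trans h2.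
  by rewrite ler_wpM2l// lerD2l lerN2 ler_pdivrMr// ler_peMr// ler1n.
rewrite leNgt; apply/negP => hlt.
have : (fun n : nat => gauss_moment s k.+1 * (1 - n.+1%:R^-1 * (s / 2))) @ \oo
    --> gauss_moment s k.+1.
  rewrite -[X in _ --> X]mulr1 -[in X in _ --> X](subr0 1).
  apply: cvgMl_tmp; apply: cvgB; first exact: cvg_cst.
  by rewrite -(mul0r (s / 2)); apply: cvgMr_tmp; exact: cvg_harmonic.
move=> /cvgr_gt/(_ _ hlt)[n _ /(_ n (leqnn _))]; apply/negP; rewrite -leNgt.
apply: le_trans (key n.+1%:R^-1 _); last by rewrite invr_gt0 ltr0n.
rewrite ler_wpM2l// lerD2l lerN2 -mulrA ler_wpM2r ?divr_ge0//.
by rewrite expr2 ler_piMl ?invr_ge0// invf_le1 ?ltr0n// ler1n.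
Qed.

Lemma gaussian_moments k :
  (\int[P]_w (Y w ^+ k.*2)%:E = (gauss_moment s k)%:E)%E.
Proof.
(* The induction also carries the expectation of the remainder for every [a]: the remainder of order
   [2 k] yields the moment of order [2 k + 2], and that moment yields the next remainder. *)
suff [] : (\int[P]_w (Y w ^+ k.*2)%:E = (gauss_moment s k)%:E)%E /\
  forall a, P.-integrable setT (EFin \o (fun w => cos_rem k.*2 (a * Y w))) /\
   (\int[P]_w (cos_rem k.*2 (a * Y w))%:E = (exp_rem k (a ^+ 2 * s / 2))%:E)%E by [].
have one_int : P.-integrable setT (EFin \o (cst 1 : Omega -> R)).
  exact: finite_measure_integrable_cst.
elim: k => [|k [_ IH]].
  split.
    under eq_integral do rewrite expr0.
    rewrite prob_integral1.
    by rewrite /gauss_moment expr0 mulr1 divff.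
  move=> a; split.
    exact: (integrableB measurableT one_int (cos_integrable a)).
  rewrite /= (integralB_EFin measurableT one_int (cos_integrable a)).
  by rewrite charY prob_integral1.
have remE a := (IH a).2.
have mom : (\int[P]_w (Y w ^+ k.+1.*2)%:E = (gauss_moment s k.+1)%:E)%E.
  by apply/eqP; rewrite eq_le moment_le ?moment_ge.
split => // a.
have Yint : P.-integrable setT (EFin \o (fun w => (a * Y w) ^+ k.+1.*2 / k.+1.*2`!%:R)).
  have -> : EFin \o (fun w => (a * Y w) ^+ k.+1.*2 / k.+1.*2`!%:R) =
     (fun w => (a ^+ k.+1.*2 / k.+1.*2`!%:R)%:E * (Y w ^+ k.+1.*2)%:E)%E.
    by apply/funext => w /=; rewrite -EFinM exprMn mulrAC.
  apply: integrableZl => //; apply/integrableP; split.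
    by apply/measurable_EFinP; exact: measurable_funX.
  under eq_integral => w _.
    rewrite gee0_abs; last by rewrite lee_fin -mul2n exprM exprn_ge0 ?sqr_ge0.
    over.
  by rewrite mom ltry.
have remES w : (cos_rem k.+1.*2 (a * Y w))%:E =
   (((a * Y w) ^+ k.+1.*2 / k.+1.*2`!%:R)%:E - (cos_rem k.*2 (a * Y w))%:E)%E.
  by rewrite doubleS cos_remSS EFinB.
split.
  have -> : EFin \o (fun w => cos_rem k.+1.*2 (a * Y w)) =
     ((EFin \o (fun w => (a * Y w) ^+ k.+1.*2 / k.+1.*2`!%:R)%R) \-
      (EFin \o (fun w => cos_rem k.*2 (a * Y w))%R))%E.
    by apply/funext => w; exact: remES.
  by apply: integrableB => //; exact: (IH a).1.
under eq_integral do rewrite remES.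
rewrite (integralB_EFin measurableT Yint (IH a).1) remE.
have -> : (\int[P]_w ((a * Y w) ^+ k.+1.*2 / k.+1.*2`!%:R)%:E)%E =
    ((a ^+ 2 * s / 2) ^+ k.+1 / k.+1`!%:R)%:E.
  under eq_integral do rewrite exprMn mulrAC EFinM.
  rewrite ge0_integralZl//.
  - by rewrite mom -EFinM gauss_moment_scale.
  - by apply/measurable_EFinP; exact: measurable_funX.
  - by move=> w _; rewrite lee_fin -mul2n exprM exprn_ge0 ?sqr_ge0.
  - by rewrite lee_fin divr_ge0// -mul2n exprM exprn_ge0 ?sqr_ge0.
by rewrite -EFinB exp_remS.
Qed.

Lemma gauss_tail_moment (a : R) k (E : set Omega) : measurable E -> 0 < a ->
  (forall w, E w -> a <= Y w) -> (P E <= (gauss_moment s k / a ^+ k.*2)%:E)%E.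
Proof.
move=> mE a0 EY; have ak : 0 < a ^+ k.*2 by rewrite exprn_gt0.
have : ((a ^+ k.*2)%:E * P E <= (gauss_moment s k)%:E)%E.
  rewrite -gaussian_moments -[E]setIT -integral_indic// -ge0_integralZl//.
  - apply: ge0_le_integral => //.
    + by move=> w _; rewrite -EFinM lee_fin mulr_ge0 ?(ltW ak).
    + by apply/measurable_EFinP; apply: measurable_funM.
    + by apply/measurable_EFinP; exact: measurable_funX.
    + move=> w _; rewrite -EFinM lee_fin indicE.
      have [/set_mem/EY aY|_] := boolP (w \in E).
        by rewrite mulr1 lerXn2r// nnegrE ?(ltW a0)// (le_trans (ltW a0)).
      by rewrite mulr0 -mul2n exprM exprn_ge0 ?sqr_ge0.
  - exact/measurable_EFinP/measurable_indic.
  - by rewrite lee_fin ltW.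
have PEfin : P E \is a fin_num by exact: fin_num_measure.
by rewrite -(fineK PEfin) -EFinM !lee_fin ler_pdivlMr// mulrC.
Qed.

End gaussian_moments.

(** * Factorial bounds and the size of Gaussian moments *)

Section factorial_bounds.

Lemma fact_addn_le n k j : (j <= k)%N -> ((n + j)`! <= n`! * (n + k) ^ j)%N.
Proof.
elim: j => [|j IH] jk; first by rewrite addn0 expn0 muln1.
rewrite addnS factS expnS mulnCA leq_mul ?IH//; last exact: ltnW.
by rewrite -addnS leq_add2l.
Qed.

Lemma fact_addn_ge n j : (n`! * n ^ j <= (n + j)`!)%N.
Proof.
elim: j => [|j IH]; first by rewrite addn0 expn0 muln1.
by rewrite addnS factS expnS mulnCA leq_mul// leqW// leq_addr.
Qed.

Lemma bin_le_exp2 n m : ('C(n, m) <= 2 ^ n)%N.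
Proof.
elim: n m => [[|m]|n IH [|m]] //; first by rewrite bin0 expn_gt0.
by rewrite binS expnS mul2n -addnn leq_add.
Qed.

(** Compares the moment of order [4 k] with the square of that of order [2 k]. It combines
    ['C(4 k, 2 k) <= 2 ^ (4 k)] with [k! ^ 2 <= (2 k)!]. *)
Lemma fact_quadruple_le k : (k.*2.*2`! * k`! ^ 2 <= 16 ^ k * k.*2`! ^ 3)%N.
Proof.
have h1 : (k.*2.*2`! <= 16 ^ k * k.*2`! ^ 2)%N.
  have := bin_fact (leq_addr k.*2 k.*2); rewrite addnK addnn => <-.
  rewrite leq_mul// -[X in (X ^ k)%N]/(2 ^ 4)%N -expnM.
  by rewrite (_ : 4 * k = k.*2.*2)%N ?bin_le_exp2// -!mul2n mulnA.
have h2 : (k`! ^ 2 <= k.*2`!)%N.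
  have := bin_fact (leq_addr k k); rewrite addnK addnn => <-.
  by rewrite leq_pmull// bin_gt0 -addnn leq_addr.
by rewrite [in leqRHS]expnSr mulnA leq_mul.
Qed.

End factorial_bounds.

Section gauss_moment_bounds.
Context {R : realType}.
Implicit Types (s : R) (k : nat).

Lemma gauss_moment_ub s k : 0 <= s -> gauss_moment s k <= (k%:R * s) ^+ k.
Proof.
move=> s0; rewrite /gauss_moment.
have kf : 0 < k`!%:R :> R by rewrite ltr0n fact_gt0.
rewrite mulrAC ler_pdivrMr// !exprMn exprVn mulrA ler_pdivrMr ?exprn_gt0//.
have : (k.*2`!%:R : R) <= k`!%:R * (k.*2%:R) ^+ k.
  by rewrite -natrX -natrM ler_nat -addnn fact_addn_le.
move=> /(ler_wpM2r (exprn_ge0 k s0)) /le_trans; apply.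
rewrite -muln2 natrM exprMn le_eqVlt; apply/orP; left; apply/eqP; ring.
Qed.

Lemma gauss_moment_lb s k : 0 <= s -> (k%:R * s / 2) ^+ k <= gauss_moment s k.
Proof.
move=> s0; rewrite /gauss_moment -mulrA exprMn ler_wpM2r ?exprn_ge0 ?divr_ge0//.
rewrite ler_pdivlMr ?ltr0n ?fact_gt0// -natrX -natrM ler_nat mulnC -addnn.
exact: fact_addn_ge.
Qed.

Lemma gauss_moment_double s k : 0 <= s ->
  gauss_moment s k.*2 <= 16 ^+ k * gauss_moment s k ^+ 2.
Proof.
move=> s0; rewrite /gauss_moment [X in _ <= _ * X]exprMn -exprM muln2 mulrA.
rewrite ler_wpM2r ?exprn_ge0 ?divr_ge0// expr_div_n mulrA.
have f0 n : 0 < n`!%:R :> R by rewrite ltr0n fact_gt0.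
rewrite ler_pdivrMr// mulrAC ler_pdivlMr ?exprn_gt0// -mulrA -exprSr.
by rewrite -!natrX -!natrM ler_nat fact_quadruple_le.
Qed.

End gauss_moment_bounds.

(** * Upper and lower Gaussian tails *)

Section gaussian_tails.
Context {R : realType} {d0 : measure_display} {Omega : measurableType d0}.
Context {P : probability Omega R} {Y : Omega -> R} {s : R}.
Hypotheses (mY : measurable_fun setT Y)
  (charY : forall a, (\int[P]_w (cos (a * Y w))%:E = (expR (- (a ^+ 2 * s / 2)))%:E)%E).

(** Markov's inequality at order [2 k], with [k] the integer part of [a ^ 2 / (4 S)]. Then
    [k s / a ^ 2 <= 1/4 <= expR (- 1)], and the summand 1 in the exponent absorbs the rounding of
    [k]. *)
Lemma gauss_tail_ub (a S : R) (E : set Omega) : measurable E -> 0 < a -> 0 < S ->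
  s <= S -> (forall w, E w -> a <= Y w) ->
  (P E <= (expR (1 - a ^+ 2 / (4 * S)))%:E)%E.
Proof.
move=> mE a0 S0 sS EY; have s0 : 0 <= s := gauss_var_ge0 mY charY.
pose x := a ^+ 2 / (4 * S); pose k := Num.truncn x.
have x0 : 0 <= x by rewrite divr_ge0 ?sqr_ge0// mulr_ge0// ltW.
have /andP[kx xk] : k%:R <= x < k.+1%:R by exact: truncn_itv.
apply: le_trans (gauss_tail_moment mY charY a k E mE a0 EY) _; rewrite lee_fin.
apply: (@le_trans _ _ (expR (- 1) ^+ k)); last first.
  by rewrite -expRM_natl ler_expR -/x; move: xk; rewrite -natr1; lra.
rewrite ler_pdivrMr ?exprn_gt0//; apply: le_trans (gauss_moment_ub s k s0) _.
rewrite -mul2n exprM -exprMn lerXn2r ?nnegrE ?(mulr_ge0 (ler0n _ _) s0)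
  ?(mulr_ge0 (expR_ge0 _) (sqr_ge0 _))//.
have e1 : 4^-1 <= expR (- 1) :> R.
  have := expR_ge1Dx (- (2^-1) : R) => h.
  have -> : -1 = - (2^-1) + - (2^-1) :> R by lra.
  rewrite expRD; apply: (@le_trans _ _ ((1 + - 2^-1) * (1 + - 2^-1))); first by lra.
  by rewrite ler_pM//; lra.
apply: (@le_trans _ _ (4^-1 * a ^+ 2)); last by rewrite ler_wpM2r ?sqr_ge0.
apply: (@le_trans _ _ (x * S)); first by rewrite ler_pM.
by rewrite /x invfM mulrA -mulrA mulVf ?gt_eqF// mulr1 mulrC.
Qed.

(** Paley-Zygmund from the pointwise bound [z <= 1 + l z ^ 2 / 2 + \1_E / (2 l)] for
    [z = Y ^ (2 k)]: if [|Y| < 1] then [z <= 1], and otherwise the arithmetic-geometric inequality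
    applies. Integration involves only the moments [m] and [M <= 16 ^ k m ^ 2]. *)
Lemma gauss_tail_lb_moment k (E : set Omega) : measurable E ->
  (forall w, 1 <= `|Y w| -> E w) -> 4 <= gauss_moment s k ->
  (((2 * 16 ^+ k)^-1)%:E <= P E)%E.
Proof.
move=> mE EY m4; have s0 : 0 <= s := gauss_var_ge0 mY charY.
pose m := gauss_moment s k; pose M := gauss_moment s k.*2.
have m0 : 0 < m by rewrite (lt_le_trans _ m4).
have Mm : M <= 16 ^+ k * m ^+ 2 by exact: gauss_moment_double.
have s_gt0 : k = 0%N \/ 0 < s.
  case: (posnP k) => [|k0]; [by left|right; rewrite lt_def s0 andbT].
  apply: contraTneq m0 => s00.
  by rewrite /m /gauss_moment s00 mul0r expr0n gtn_eqF// mulr0 ltxx.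
have M0 : 0 < M.
  rewrite /M /gauss_moment mulr_gt0 ?divr_gt0 ?ltr0n ?fact_gt0//.
  by case: s_gt0 => [->|?]; rewrite ?expr0// exprn_gt0// divr_gt0.
(* With this [l] the integrated bound reads [m <= 1 + m / 4 + (M / m) P E]; since [m >= 4], the last
   term is at least [m / 2]. *)
pose l := m / (2 * M); have l0 : 0 < l by rewrite divr_gt0// mulr_gt0.
have PEfin : P E \is a fin_num by exact: fin_num_measure.
pose r := fine (P E).
have even_ge0 (y : R) n : 0 <= y ^+ n.*2 by rewrite -mul2n exprM exprn_ge0 ?sqr_ge0.
have mX n : measurable_fun setT (fun w => (Y w ^+ n)%:E).
  by apply/measurable_EFinP; exact: measurable_funX.
have mI : measurable_fun setT (fun w => (\1_E w : R)%:E).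
  exact/measurable_EFinP/measurable_indic.
pose F w : R := l / 2 * Y w ^+ k.*2.*2; pose G w : R := (2 * l)^-1 * \1_E w.
have F0 w : 0 <= F w by rewrite mulr_ge0 ?even_ge0// divr_ge0// ltW.
have G0 w : 0 <= G w by rewrite mulr_ge0// invr_ge0 mulr_ge0// ltW.
have mF : measurable_fun setT F.
  by apply: measurable_funM => //; exact: measurable_funX.
have mG : measurable_fun setT G.
  by apply: measurable_funM => //; exact: measurable_indic.
have intF : (\int[P]_w (F w)%:E = (m / 4)%:E)%E.
  have l2 : (0 <= (l / 2)%:E)%E by rewrite lee_fin ltW// divr_gt0.
  rewrite /F; under eq_integral do rewrite EFinM.
  rewrite ge0_integralZl//; last by move=> w _; rewrite lee_fin.
  rewrite (gaussian_moments mY charY) -EFinM -/M /l; congr EFin.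
  by field; rewrite gt_eqF.
have intG : (\int[P]_w (G w)%:E = (M / m * r)%:E)%E.
  have IE : (\int[P]_w (\1_E w : R)%:E = r%:E)%E.
    by rewrite integral_indic// setIT /r fineK.
  have l2 : (0 <= ((2 * l)^-1)%:E)%E by rewrite lee_fin invr_ge0 ltW// mulr_gt0.
  rewrite /G; under eq_integral do rewrite EFinM.
  rewrite ge0_integralZl// IE -EFinM /l; congr EFin.
  by field; rewrite !gt_eqF.
have key : m <= 1 + m / 4 + M / m * r.
  rewrite -lee_fin !EFinD -intF -intG -[m%:E](gaussian_moments mY charY).
  have m1F : measurable_fun setT (fun w => (1 + F w)%:E).
    by apply/measurable_EFinP; exact: measurable_funD.
  have m1FG : measurable_fun setT (fun w => (1 + F w + G w)%:E).
    by apply/measurable_EFinP; do 2 apply: measurable_funD => //.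
  have -> : (1%:E + \int[P]_w (F w)%:E + \int[P]_w (G w)%:E =
             \int[P]_w (1 + F w + G w)%:E)%E.
    under [in RHS]eq_integral do rewrite EFinD.
    rewrite ge0_integralD//; last 3 first.
    - by move=> w _; rewrite lee_fin addr_ge0.
    - by move=> w _; rewrite lee_fin.
    - exact/measurable_EFinP.
    under [in RHS]eq_integral do rewrite EFinD.
    rewrite ge0_integralD//; last 2 first.
    - by move=> w _; rewrite lee_fin.
    - exact/measurable_EFinP.
    by rewrite prob_integral1.
  apply: ge0_le_integral => //.
  - by move=> w _; rewrite lee_fin.
  - move=> w _; rewrite lee_fin.
    have [Y1|Y1] := leP 1 `|Y w|; last first.
      rewrite -addrA ler_wpDr ?addr_ge0//.
      by rewrite (le_trans (ler_norm _))// normrX exprn_ile1// ltW.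
    rewrite /F /G indicE mem_set ?mulr1; last exact: EY.
    rewrite -[k.*2.*2]muln2 exprM; set z := Y w ^+ k.*2.
    rewrite -addrA ler_wpDl// -subr_ge0.
    have -> : l / 2 * z ^+ 2 + (2 * l)^-1 - z = (2 * l)^-1 * (l * z - 1) ^+ 2.
      by field; rewrite gt_eqF.
    by rewrite mulr_ge0 ?sqr_ge0// invr_ge0 mulr_ge0// ltW.
have r0 : 0 <= r by rewrite fine_ge0.
rewrite -(fineK PEfin) lee_fin -/r -[leLHS]mul1r.
rewrite ler_pdivrMr ?mulr_gt0 ?exprn_gt0//.
have h : m / 2 <= M / m * r by move: key m4; rewrite -/m; lra.
have {}h : m ^+ 2 / 2 <= M * r.
  have := ler_wpM2l (ltW m0) h.
  have -> : m * (M / m * r) = M * r by field; rewrite gt_eqF.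
  by rewrite expr2; lra.
have {}h := le_trans h (ler_wpM2r r0 Mm).
have : m ^+ 2 * 2^-1 <= m ^+ 2 * (16 ^+ k * r)
  by rewrite mulrA [m ^+ 2 * 16 ^+ k]mulrC.
by rewrite ler_pM2l ?exprn_gt0//; lra.
Qed.

(** An integer [k] just above [8 / S] makes the moment at least 4. Then
    [2 16 ^ k <= 32 ^ k <= expR (5 k)], and [k <= 9 / S] because [S <= 1], whence 45. *)
Lemma gauss_tail_lb (S : R) (E : set Omega) : measurable E -> 0 < S -> S <= 1 ->
  S <= s -> (forall w, 1 <= `|Y w| -> E w) ->
  ((expR (- (45 / S)))%:E <= P E)%E.
Proof.
move=> mE S0 S1 Ss EY; have s0 : 0 <= s := gauss_var_ge0 mY charY.
pose k := (Num.truncn (8 / S)).+1.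
have x0 : 0 <= 8 / S by rewrite divr_ge0// ltW.
have /andP[] := truncn_itv x0; rewrite -/k => kx xk.
have m4 : 4 <= gauss_moment s k.
  apply: le_trans (gauss_moment_lb s k s0).
  have h : 4 <= k%:R * s / 2.
    have : 8 <= k%:R * S by rewrite -ler_pdivrMr// ltW.
    by have := ler_wpM2l (ler0n R k) Ss; lra.
  by apply: (le_trans h); rewrite -[leLHS]expr1 ler_weXn2l//; lra.
apply: le_trans (gauss_tail_lb_moment k E mE EY m4); rewrite lee_fin.
have e5 : 32 <= expR 5 :> R.
  have -> : 32 = 2 ^+ 5 :> R by ring.
  have -> : 5 = 5%:R * 1 :> R by rewrite mulr1.
  rewrite expRM_natl lerXn2r ?nnegrE ?expR_ge0//.
  by have := expR_ge1Dx (1 : R); lra.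
rewrite expRN lef_pV2 ?posrE ?expR_gt0 ?mulr_gt0 ?exprn_gt0//.
apply: (@le_trans _ _ (32 ^+ k)).
  have -> : 32 = 2 * 16 :> R by ring.
  by rewrite exprMn ler_pM2r ?exprn_gt0// -[leLHS]expr1 ler_weXn2l//; lra.
apply: (@le_trans _ _ (expR 5 ^+ k)); first by rewrite lerXn2r ?nnegrE ?expR_ge0.
rewrite -expRM_natl ler_expR.
have : k%:R <= 9 / S.
  rewrite /k -natr1; apply: (@le_trans _ _ (8 / S + S^-1)).
    by rewrite lerD// invf_ge1.
  by rewrite -[X in _ + X]mul1r -mulrDl ler_wpM2r ?invr_ge0 ?(ltW S0)//; lra.
lra.
Qed.

End gaussian_tails.

(** * Points on a great circle *)

Section circle_points.
Context {R : realType} (d : nat).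
Implicit Types (u v : 'rV[R]_d.+1) (x y s t e : R).

Lemma dotC u v : dot u v = dot v u.
Proof. by apply: eq_bigr => i _; rewrite mulrC. Qed.

Lemma dot_sub u v : dot (u - v) (u - v) = dot u u - 2 * dot u v + dot v v.
Proof.
rewrite /dot mulr_sumr -sumrB -big_split/=; apply: eq_bigr => i _.
by rewrite !mxE; ring.
Qed.

Definition planar x y : 'rV[R]_d.+1 :=
  \row_i (x * (i == ord_max)%:R + y * (i == ord0)%:R).

Lemma dot_planar x y x' y' : (0 < d)%N ->
  dot (planar x y) (planar x' y') = x * x' + y * y'.
Proof.
move=> d0; rewrite /dot.
have nm : (ord0 == ord_max :> 'I_d.+1) = false.
  by rewrite -val_eqE /= eq_sym gtn_eqF.
have nm' : (ord_max == ord0 :> 'I_d.+1) = false by rewrite eq_sym.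
rewrite (bigD1 ord_max)//= (bigD1 ord0) ?nm//= big1 => [|i /andP[/negbTE h1 /negbTE h2]].
  by rewrite /planar !mxE !eqxx nm nm' /=; ring.
by rewrite /planar !mxE h1 h2 /=; ring.
Qed.

(* Rational parametrization of a great circle. *)
Definition circle_pt s : sph R d :=
  insubd (north R d) (planar ((1 - s ^+ 2) / (1 + s ^+ 2)) (2 * s / (1 + s ^+ 2))).

Let den_gt0 s : 0 < 1 + s ^+ 2. Proof. by rewrite ltr_pwDl ?sqr_ge0. Qed.

Let den_neq0 s : 1 + s ^+ 2 != 0. Proof. by rewrite gt_eqF. Qed.

Lemma dot_circle s t : (0 < d)%N ->
  1 - dot (val (circle_pt s)) (val (circle_pt t)) =
  2 * (s - t) ^+ 2 / ((1 + s ^+ 2) * (1 + t ^+ 2)).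
Proof.
move=> d0; rewrite /circle_pt !val_insubd !dot_planar//.
have E (r : R) : ((1 - r ^+ 2) / (1 + r ^+ 2)) * ((1 - r ^+ 2) / (1 + r ^+ 2)) +
  2 * r / (1 + r ^+ 2) * (2 * r / (1 + r ^+ 2)) == 1.
  by apply/eqP; field; rewrite den_neq0.
rewrite !E dot_planar//; field.
by rewrite !den_neq0.
Qed.

Lemma dist_circle s t : (0 < d)%N ->
  dot (val (circle_pt s) - val (circle_pt t)) (val (circle_pt s) - val (circle_pt t))
  <= 4 * (s - t) ^+ 2.
Proof.
move=> d0; have v1 (x : sph R d) : dot (val x) (val x) = 1 by exact/eqP/(valP x).
rewrite dot_sub !v1.
have -> : 1 - 2 * dot (val (circle_pt s)) (val (circle_pt t)) + 1 =
  2 * (1 - dot (val (circle_pt s)) (val (circle_pt t))) by ring.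
rewrite dot_circle// mulrA ler_pdivrMr ?mulr_gt0//.
have -> : 2 * (2 * (s - t) ^+ 2) = 4 * (s - t) ^+ 2 by ring.
rewrite ler_peMr ?(mulr_ge0 _ (sqr_ge0 _))//.
by rewrite mulr_ege1// lerDl sqr_ge0.
Qed.

(** The parameter is the tangent of half the angle to the North Pole, so []0, 1[] covers a quarter
    circle, on which scalar products are nonnegative. *)
Lemma dot_circle_itv s t : (0 < d)%N -> 0 < s < 1 -> 0 < t < 1 -> s != t ->
  0 <= dot (val (circle_pt s)) (val (circle_pt t)) < 1.
Proof.
move=> d0 /andP[s0 s1] /andP[t0 t1] st; have := dot_circle s t d0.
set D := dot _ _ => DE.
have n0 : 0 < (s - t) ^+ 2 by rewrite lt_def sqr_ge0 sqrf_eq0 subr_eq0 st.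
have m0 : 0 < (1 + s ^+ 2) * (1 + t ^+ 2) by rewrite mulr_gt0.
have D1 : 0 < 1 - D by rewrite DE divr_gt0// mulr_gt0.
suff : 1 - D <= 1 by lra.
rewrite DE ler_pdivrMr// mul1r.
have h1 : 0 <= s * t by rewrite mulr_ge0// ltW.
have h2 : 0 <= (1 - s ^+ 2) * (1 - t ^+ 2).
  by rewrite mulr_ge0// subr_ge0 exprn_ile1// ltW.
lra.
Qed.

Lemma circle_near (f : sph R d -> R) s e : (0 < d)%N -> sph_continuous f -> 0 < e ->
  exists2 del, 0 < del & forall t, `|t - s| <= del ->
    `|f (circle_pt t) - f (circle_pt s)| < e.
Proof.
move=> d0 fc e0; have [del del0 H] := fc (circle_pt s) e e0.
(* For [|t - s| <= 1] the squared distance is at most [4 |t - s|]; the 5 makes the resulting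
   inequality strict. *)
exists (Num.min 1 (del / 5)); first by rewrite lt_min ltr01 divr_gt0.
move=> t; rewrite le_min => /andP[h1 h2]; apply: H.
apply: le_lt_trans (dist_circle t s d0) _.
rewrite -[(t - s) ^+ 2]real_normK ?num_real//.
have : `|t - s| ^+ 2 <= 1 * `|t - s| by rewrite expr2 ler_wpM2r.
have := normr_ge0 (t - s); lra.
Qed.

End circle_points.

(** * Alternating sums and the variance of contrasts *)

Section alternating_sums.
Context {R : realType}.

(** Used in two ways: a constant sums to 0, and the values at the two centres sum to [n] copies of
    their increment. *)
Lemma sum_sign_double (f : bool -> R) n :
  \sum_(i < n.*2) (-1) ^+ i * f (odd i) = n%:R * (f false - f true).
Proof.
elim: n => [|n IH]; first by rewrite big_ord0 mul0r.
have e : (-1) ^+ n.*2 = 1 :> R by rewrite -mul2n exprM sqrrN !expr1n.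
by rewrite doubleS !big_ord_recr/= IH odd_double exprS e -natr1 /=; ring.
Qed.

(* For coefficients summing to zero the common off-diagonal covariance [1 - U]
   cancels, so the variance is of order [m U] and not [m ^ 2]. *)
Lemma contrast_variance_le m (a : 'I_m -> R) (K : 'I_m -> 'I_m -> R) (U e : R) :
  (forall i, `|a i| = 1) -> \sum_i a i = 0 -> (forall i, K i i = 1) ->
  (forall i j, i != j -> `|K i j - (1 - U)| <= e) -> 0 <= e ->
  \sum_i \sum_j a i * a j * K i j <= m%:R * U + m%:R ^+ 2 * e.
Proof.
move=> a1 a0 K1 KU e0.
have -> : \sum_i \sum_j a i * a j * K i j =
    \sum_i \sum_j a i * a j * (1 - U) +
    \sum_i \sum_j a i * a j * (K i j - (1 - U)).
  rewrite -big_split/=; apply: eq_bigr => i _; rewrite -big_split/=.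
  by apply: eq_bigr => j _; ring.
have -> : \sum_i \sum_j a i * a j * (1 - U) = 0.
  rewrite big1// => i _; rewrite -mulr_suml -mulr_sumr a0; ring.
rewrite add0r.
have -> : m%:R * U + m%:R ^+ 2 * e = \sum_(i < m) (U + \sum_(j < m) e).
  rewrite big_split/= !sumr_const !card_ord -[U *+ m]mulr_natl -[e *+ m]mulr_natl.
  by rewrite -[(_ * e) *+ m]mulr_natl; ring.
apply: ler_sum => i _; rewrite (bigD1 i)//= K1 lerD//.
  have -> : a i * a i = 1 by rewrite -expr2 -real_normK ?num_real// a1 expr1n.
  by rewrite le_eqVlt; apply/orP; left; apply/eqP; ring.
rewrite [leRHS](bigD1 i)//= ler_wpDl//; apply: ler_sum => j ji.
apply: le_trans (ler_norm _) _; rewrite normrM normrM !a1 !mul1r.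
by apply: KU; rewrite eq_sym.
Qed.

End alternating_sums.

Lemma eventually_fin (I : finType) (Q : I -> nat -> Prop) :
  (forall i, exists N, forall L, (N <= L)%N -> Q i L) ->
  exists N, forall L, (N <= L)%N -> forall i, Q i L.
Proof.
move=> /choice[N HN]; exists (\max_i N i)%N => L NL i; apply: HN.
exact: leq_trans (leq_bigmax i) NL.
Qed.

(** * Linear combinations of the field, log-probabilities, open and closed sets *)

Section gaussian_field.
Context {R : realType} {d : nat} {d0 : measure_display} {Omega : measurableType d0}.
Context {P : probability Omega R} {T : Omega -> sph R d -> R}
  {K : sph R d -> sph R d -> R}.
Hypothesis gT : centered_gaussian_field P T K.

Lemma field_comb_measurable n (xs : 'I_n -> sph R d) (a : 'I_n -> R) :
  measurable_fun setT (fun w => \sum_(i < n) a i * T w (xs i)).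
Proof. by apply: measurable_sum => i; apply: measurable_funM => //; exact: gT.1. Qed.

Lemma field_comb_char n (xs : 'I_n -> sph R d) (a : 'I_n -> R) b :
  (\int[P]_w (cos (b * \sum_(i < n) a i * T w (xs i)))%:E =
  (expR (- (b ^+ 2 * (\sum_(i < n) \sum_(j < n) a i * a j * K (xs i) (xs j)) / 2)))%:E)%E.
Proof.
have [+ _] := gT.2 n xs (fun i => b * a i).
have -> : \sum_(i < n) \sum_(j < n) b * a i * (b * a j) * K (xs i) (xs j) =
    b ^+ 2 * \sum_(i < n) \sum_(j < n) a i * a j * K (xs i) (xs j).
  rewrite mulr_sumr; apply: eq_bigr => i _; rewrite mulr_sumr.
  by apply: eq_bigr => j _; ring.
rewrite unlock => <-; apply: eq_integral => w _.
by rewrite mulr_sumr; under eq_bigr do rewrite mulrA.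
Qed.

End gaussian_field.

Section elog.
Context {R : realType}.
Implicit Types (p : \bar R) (x : R).

Lemma elog_le p x : (0 <= p)%E -> (p <= (expR x)%:E)%E -> (elog p <= x%:E)%E.
Proof.
case: p => [r| |]//=; rewrite !lee_fin => r0 rx.
case: ifPn => [r1|_]; last exact: leNye.
by rewrite lee_fin -[x]expRK ler_ln ?posrE ?expR_gt0.
Qed.

Lemma elog_ge p x : ((expR x)%:E <= p)%E -> (x%:E <= elog p)%E.
Proof.
case: p => [r| |]//=; last by move=> _; exact: leey.
rewrite lee_fin => xr; have r0 := lt_le_trans (expR_gt0 x) xr.
by rewrite r0 lee_fin -[x]expRK ler_ln ?posrE ?expR_gt0.
Qed.

End elog.

Section open_closed.
Context {R : realType} {d : nat}.

Lemma Copen_comb m (a : 'I_m -> R) (z : 'I_m -> sph R d) (b : R) :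
  (forall i, `|a i| = 1) ->
  Copen [set f : sph R d -> R | Csph f /\ b < \sum_i a i * f (z i)].
Proof.
move=> a1; split=> [f []//|f [fc bf]].
set F := \sum_i a i * f (z i) in bf.
pose e := (F - b) / (2 * m.+1%:R).
have e0 : 0 < e by rewrite divr_gt0 ?subr_gt0// mulr_gt0.
exists e => // g gc fg; split => //.
have : F - \sum_i a i * g (z i) <= m%:R * e.
  rewrite /F -sumrB; apply: (@le_trans _ _ (\sum_(i < m) e)).
    apply: ler_sum => i _; rewrite -mulrBr.
    by apply: le_trans (ler_norm _) _; rewrite normrM a1 mul1r.
  by rewrite sumr_const card_ord mulr_natl.
have : m%:R * e < F - b.
  rewrite /e mulrA ltr_pdivrMr ?mulr_gt0// mulrC ltr_pM2l ?subr_gt0//.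
  have : 0 <= m%:R :> R by [].
  by rewrite -natr1; lra.
lra.
Qed.

Lemma Cclosed_osc (x y : sph R d) :
  Cclosed [set f : sph R d -> R | Csph f /\ 1 <= `|f x - f y|].
Proof.
split=> [f []//|]; split=> [f []//|f [fc nf]].
have {}nf : `|f x - f y| < 1 by rewrite ltNge; apply/negP => h; apply: nf.
exists ((1 - `|f x - f y|) / 4); first by rewrite divr_gt0 ?subr_gt0.
move=> g gc fg; split=> // -[_]; apply/negP; rewrite -ltNge.
have := fg x; have := fg y; have := ler_normD (f x - f y) ((g x - f x) + (f y - g y)).
have := ler_normD (g x - f x) (f y - g y); rewrite (distrC (g x)).
have -> : f x - f y + (g x - f x + (f y - g y)) = g x - g y by ring.
by move: nf; set A := `|_|; lra.
Qed.

End open_closed.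

Lemma measurable_gt {R : realType} {d0 : measure_display} {Omega : measurableType d0}
  (Y : Omega -> R) (b : R) : measurable_fun setT Y -> measurable [set w | b < Y w].
Proof.
move=> mY; have := mY measurableT _ (measurable_itv `]b, +oo[); rewrite setTI.
by congr measurable; apply/seteqP; split => w /=; rewrite in_itv/= andbT.
Qed.

Lemma measurable_ge {R : realType} {d0 : measure_display} {Omega : measurableType d0}
  (Y : Omega -> R) (b : R) : measurable_fun setT Y -> measurable [set w | b <= Y w].
Proof.
move=> mY; have := mY measurableT _ (measurable_itv `[b, +oo[); rewrite setTI.
by congr measurable; apply/seteqP; split => w /=; rewrite in_itv/= andbT.
Qed.

(** * Distinct parameters clustering at two centres *)

Section contrast_points.
Context {R : realType}.
Implicit Types (eta : R) (i j : nat).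

Definition center (o : bool) : R := if o then 3 / 4 else 1 / 4.

(** Even indices lie near 1/4 and odd ones near 3/4. Within one parity the terms [eta / i.+2]
    separate the points; across parities [eta <= 1/8] does. *)
Definition param eta i : R := center (odd i) + eta / i.+2%:R.

Lemma param_dist eta i : 0 < eta -> `|param eta i - center (odd i)| <= eta.
Proof.
move=> e0; rewrite /param addrAC subrr add0r ger0_norm; last by rewrite divr_ge0// ltW.
by rewrite ler_pdivrMr// ler_peMr ?(ltW e0)// ler1n.
Qed.

Lemma param_itv eta i : 0 < eta <= 8^-1 -> 0 < param eta i < 1.
Proof.
move=> /andP[e0 e1]; have := param_dist eta i e0; rewrite ler_norml.
by rewrite /center; case: odd; lra.
Qed.

Lemma param_inj eta : 0 < eta <= 8^-1 -> injective (param eta).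
Proof.
move=> /andP[e0 e1] i j ij; have := param_dist eta i e0; have := param_dist eta j e0.
have [oij|oij] := eqVneq (odd i) (odd j).
  move=> _ _; move: ij; rewrite /param oij => /addrI/(mulfI _)/invr_inj/eqP.
  by rewrite gt_eqF// => /(_ isT); rewrite eqr_nat eqSS eqSS => /eqP.
rewrite !ler_norml ij /center.
by case: (odd i) (odd j) oij => -[]//= _ h1 h2; exfalso; lra.
Qed.

End contrast_points.

Definition speed {R : realType} (rho : R) (L : nat) : R := L.+1%:R `^ (rho - 1)^-1.

(** * Failure of the large deviation principle *)

Section no_LDP.
Context {R : realType} {d : nat} {J : nat -> R} {c rho : R}
  {d0 : measure_display} {Omega : measurableType d0}
  {P : probability Omega R} {T : nat -> Omega -> sph R d -> R}.
Hypotheses (d_gt0 : (0 < d)%N) (k1 : kappa J 1 = 1)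
  (klim : (fun t => (kappa J 1 - kappa J t) / (1 - t)) @ (1 : R)^'- --> (1 : R))
  (c0 : c != 0) (rho1 : 1 < rho)
  (kexp : (fun t => (1 - kappa J t - (1 - t) + c * (1 - t) `^ rho) / (1 - t) `^ rho)
     @ (1 : R)^'- --> (0 : R))
  (gT : forall L, centered_gaussian_field P (T L)
     (fun x y => iter L.+1 (kappa J) (dot (val x) (val y)))).

Local Notation v := (speed rho).
Local Notation pt := (circle_pt d).
Local Notation x0 := (pt (center false : R)).
Local Notation y0 := (pt (center true : R)).

Let kge0 (t : R) : 0 <= t <= 1 -> 0 <= kappa J t. Proof. exact: kappa_ge0. Qed.

Let kle (s t : R) : 0 <= s -> s <= t -> t <= 1 -> kappa J s <= kappa J t.
Proof. exact: kappa_le. Qed.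

Let kchord (s t : R) : 0 <= s -> s <= t -> t <= 1 ->
  (1 - kappa J s) * (1 - t) <= (1 - kappa J t) * (1 - s).
Proof. exact: kappa_chord. Qed.

Lemma speed_ge1 L : 1 <= v L.
Proof.
rewrite -(powRr0 (L.+1%:R : R)) ler_powR ?ler1n// invr_ge0 subr_ge0 ltW//.
Qed.

Lemma speed_gt0 L : 0 < v L. Proof. exact: lt_le_trans (speed_ge1 L). Qed.

Lemma dot_self (x : sph R d) : dot (val x) (val x) = 1.
Proof. exact/eqP/(valP x). Qed.

Lemma dot_centers : 0 <= dot (val x0) (val y0) < 1.
Proof.
apply: dot_circle_itv => //; rewrite /center; [lra|lra|].
by apply/eqP; lra.
Qed.

Lemma increment_lower : exists b N, 0 < b /\ forall L, (N <= L)%N ->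
  ((- (45 / b * v L))%:E <= elog (P [set w | (1 <= `|T L w x0 - T L w y0|)%R]))%E.
Proof.
have v0 := speed_gt0; have /andP[t0 t1] := dot_centers.
have [b [B [N [b0 B0 HN]]]] :=
  orbit_bounds k1 kge0 kle kchord klim c0 rho1 kexp _ t0 t1.
(* The cap at 1 makes the variance bound [b' / v L] at most 1, as [gauss_tail_lb] requires. *)
pose b' := Num.min b 1; exists b', N.
have b'0 : 0 < b' by rewrite lt_min b0 ltr01.
split=> // L /HN/andP[h _]; apply: elog_ge.
pose z (i : 'I_2) := if i == ord0 then x0 else y0.
pose a (i : 'I_2) : R := if i == ord0 then 1 else -1.
have YE w : \sum_(i < 2) a i * T L w (z i) = T L w x0 - T L w y0.
  by rewrite !big_ord_recl big_ord0 /a /z/=; ring.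
have mY := field_comb_measurable (gT L) 2 z a.
have chY := field_comb_char (gT L) 2 z a.
have -> : 45 / b' * v L = 45 / (b' / v L) by rewrite invf_div mulrA mulrAC.
apply: (gauss_tail_lb mY chY).
- have := mY; under eq_fun do rewrite YE; move=> mY'.
  apply: measurable_ge; apply: (measurable_continuous_comp Num.norm) => //.
  exact: norm_continuous.
- by rewrite divr_gt0.
- by rewrite ler_pdivrMr// mul1r (le_trans _ (speed_ge1 L))// ge_min lexx orbT.
- rewrite !big_ord_recl !big_ord0.
  have [-> -> -> ->] : [/\ z ord0 = x0, z (lift ord0 ord0) = y0, a ord0 = 1
    & a (lift ord0 ord0) = -1] by [].
  rewrite !dot_self (dotC _ (val y0)) (iter_kern_one k1).
  have : b' / v L <= b / v L by rewrite ler_wpM2r ?invr_ge0 ?(ltW (v0 L))// ge_min lexx.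
  have : 0 < b' / v L by rewrite divr_gt0.
  by move: h; rewrite -/(speed rho L); lra.
- by move=> w; rewrite YE.
Qed.

(** The constant [B] is chosen before [n], so the cost at speed [v] grows linearly in [n]; only the
    rank [N] depends on [n], [sg] and [eta]. *)
Lemma contrast_upper : exists2 B, 0 < B & forall n (sg eta : R),
  (0 < n)%N -> `|sg| = 1 -> 0 < eta <= 8^-1 ->
  exists N, forall L, (N <= L)%N ->
  (elog (P [set w | (n%:R / 4 < \sum_(i < n.*2) sg * (-1) ^+ i * T L w (pt (param eta i)))%R])
    <= (1 - n%:R * v L / (256 * B))%:E)%E.
Proof.
have v0 := speed_gt0; have /andP[t0 t1] := dot_centers.
have [b [B [N0 [b0 B0 HN0]]]] :=
  orbit_bounds k1 kge0 kle kchord klim c0 rho1 kexp _ t0 t1.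
exists B => // n sg eta n0 sg1 heta.
pose m := n.*2; pose z (i : 'I_m) := pt (param eta i).
pose a (i : 'I_m) : R := sg * (-1) ^+ i.
have m0 : 0 < m%:R :> R by rewrite ltr0n double_gt0.
pose K L (x y : sph R d) : R := iter L.+1 (kappa J) (dot (val x) (val y)).
(* At accuracy [B / m] the [m ^ 2] covariance errors total at most [m B / v L], the same bound as
   for the main term [m U]. *)
have e0 : 0 < B / m%:R by rewrite divr_gt0.
have close (ij : 'I_m * 'I_m) : exists N, forall L, (N <= L)%N -> ij.1 != ij.2 ->
    `|K L (z ij.1) (z ij.2) - K L x0 y0| <= B / m%:R / v L.
  case: ij => i j /=; have [->|ij] := eqVneq i j; first by exists 0%N.
  have /andP[s0 s1] : 0 <= dot (val (z i)) (val (z j)) < 1.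
    apply: dot_circle_itv; rewrite ?param_itv//.
    by apply: contra_neq ij => /(param_inj eta heta)/val_inj.
  have [N HN] := orbit_diff k1 kge0 kle kchord klim c0 rho1 kexp _ _ _ s0 s1 t0 t1 e0.
  by exists N => L /HN.
have [N1 HN1] := eventually_fin _ _ close.
exists (maxn N0 N1) => L; rewrite geq_max => /andP[/HN0/andP[_ hU] /HN1 hK].
apply: elog_le; first exact: measure_ge0.
have mY := field_comb_measurable (gT L) m z a.
have chY := field_comb_char (gT L) m z a.
set U := 1 - _ in hU.
have a1 i : `|a i| = 1 by rewrite normrM sg1 mul1r normrX normrN1 expr1n.
have asum : \sum_i a i = 0.
  rewrite -mulr_sumr; have := sum_sign_double (fun=> (1 : R)) n.
  by under eq_bigr do rewrite mulr1; rewrite subrr mulr0 => ->; rewrite mulr0.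
(* The variance bound is [2 m B / v L] with [m = 2 n]; together with the level [n / 4] it produces
   the constant 256. *)
have S0 : 0 < 4 * n%:R * B / v L by rewrite divr_gt0// !mulr_gt0// ltr0n.
have := gauss_tail_ub mY chY (n%:R / 4) (4 * n%:R * B / v L)
  [set w | (n%:R / 4 < \sum_(i < m) a i * T L w (z i))%R].
have -> : (n%:R / 4) ^+ 2 / (4 * (4 * n%:R * B / v L)) = n%:R * v L / (256 * B).
  by field; rewrite !gt_eqF// ltr0n.
apply => //.
- exact: measurable_gt.
- by rewrite divr_gt0// ltr0n.
- apply: le_trans (contrast_variance_le m a (fun i j => K L (z i) (z j)) U
    (B / m%:R / v L) a1 asum _ _ _) _.
  + by move=> i; rewrite /K dot_self iter_kern_one.
  + move=> i j ij; have := hK (i, j) ij; congr (`|_ - _| <= _).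
    by rewrite /U subKr.
  + by rewrite divr_ge0// ltW.
  + have : m%:R * U <= m%:R * (B / v L) by rewrite ler_wpM2l// ltW.
    have -> : m%:R ^+ 2 * (B / m%:R / v L) = m%:R * (B / v L) by field; rewrite !gt_eqF.
    rewrite /m -mul2n natrM; lra.
- by move=> w /ltW.
Qed.

(** Both centerings subtract from each sample path a number independent of the point, so they fit
    this single hypothesis on increments. *)
Lemma no_LDP_of_increments (X : nat -> Omega -> sph R d -> R) :
  (forall L w x y, X L w x - X L w y = T L w x - T L w y) ->
  (forall L w, sph_continuous (X L w)) -> ~ LDP P X v.
Proof.
move=> XT Xc [I [_ [ub lb]]]; have v0 := speed_gt0.
pose C : set (sph R d -> R) := [set f | Csph f /\ 1 <= `|f x0 - f y0|].
have [B B0 HB] := contrast_upper.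
have Iinf f : C f -> I f = +oo%E.
  move=> [fc f1].
  pose sg : R := if 0 <= f x0 - f y0 then 1 else -1.
  have sg1 : `|sg| = 1 by rewrite /sg; case: ifP; rewrite ?normrN normr1.
  have sgf : 1 <= sg * (f x0 - f y0).
    move: f1; rewrite /sg; case: ifPn => [h|]; first by rewrite ger0_norm// mul1r.
    by rewrite -ltNge => h; rewrite ltr0_norm// mulN1r.
  have [|del1 del10 H1] := circle_near d f (center false) (4^-1) d_gt0 fc; first by lra.
  have [|del2 del20 H2] := circle_near d f (center true) (4^-1) d_gt0 fc; first by lra.
  pose eta := Num.min (8^-1) (Num.min del1 del2).
  have heta : 0 < eta <= 8^-1.
    by rewrite !lt_min del10 del20 ge_min lexx !andbT invr_gt0.
  have near i : `|f (pt (param eta i)) - f (pt (center (odd i)))| < 4^-1.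
    have /andP[eta0 _] := heta; have := param_dist eta i eta0.
    have e1 : eta <= del1 by rewrite /eta !ge_min lexx orbT.
    have e2 : eta <= del2 by rewrite /eta !ge_min lexx !orbT.
    by case: (odd i) => h; [apply: H2|apply: H1]; exact: le_trans h _.
  have low n : (0 < n)%N -> ((n%:R / (256 * B) - 1)%:E <= I f)%E.
    move=> n0; pose m := n.*2.
    pose a (i : 'I_m) : R := sg * (-1) ^+ i; pose z (i : 'I_m) := pt (param eta i).
    have a1 i : `|a i| = 1 by rewrite normrM sg1 mul1r normrX normrN1 expr1n.
    pose O : set (sph R d -> R) := [set g | Csph g /\ n%:R / 4 < \sum_i a i * g (z i)].
    have asum (h : bool -> R) : \sum_(i < m) a i * h (odd i) = n%:R * (sg * (h false - h true)).
      rewrite mulrCA -(sum_sign_double h n) mulr_sumr.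
      by apply: eq_bigr => i _; rewrite mulrA.
    (* The ideal sum at the centres is at least [n], and the [2 n] errors below 1/4 remove at most
       [n / 2], which leaves more than [n / 4]. *)
    have Of : O f.
      split=> //; apply: (@lt_le_trans _ _ (\sum_i a i * f (pt (center (odd i))) - m%:R * 4^-1)).
        rewrite (asum (fun o => f (pt (center o)))) /m -mul2n natrM.
        have : n%:R * 1 <= n%:R * (sg * (f x0 - f y0)) by rewrite ler_wpM2l.
        have : 0 < n%:R :> R by rewrite ltr0n.
        lra.
      rewrite lerBlDr -lerBlDl -sumrB.
      apply: (@le_trans _ _ (\sum_(i < m) 4^-1)); last first.
        by rewrite sumr_const card_ord mulr_natl.
      apply: ler_sum => i _; rewrite -mulrBr (le_trans (ler_norm _))//.
      by rewrite normrM a1 mul1r distrC ltW// near.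
    have [N HN] := HB n sg eta n0 sg1 heta.
    have := lb O (Copen_comb m a z (n%:R / 4) a1).
    set l := limn_einf _ => hl.
    have : (l <= (1 - n%:R / (256 * B))%:E)%E.
      apply: (limn_einf_le _ _ N) => L NL.
      have -> : [set w | O (X L w)] =
          [set w | (n%:R / 4 < \sum_(i < n.*2) sg * (-1) ^+ i * T L w (pt (param eta i)))%R].
        (* The coefficients sum to zero, so the shift between [X L w] and [T L w] cancels. *)
        have XE w : \sum_i a i * X L w (z i) = \sum_i a i * T L w (z i).
          apply/eqP; rewrite -subr_eq0 -sumrB; apply/eqP.
          transitivity (\sum_(i < m) a i * (X L w x0 - T L w x0)).
            apply: eq_bigr => i _; rewrite -mulrBr; congr (_ * _).
            by have := XT L w (z i) x0; lra.
          by rewrite (asum (fun=> X L w x0 - T L w x0)) subrr !mulr0.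
        apply/seteqP; split => w /=; first by move=> []; rewrite XE.
        by move=> h; split; [exact: Xc|rewrite XE].
      (* After division by [v L >= 1] the additive 1 stays at most 1 and the linear cost no longer
         depends on [L]. *)
      apply: (@le_trans _ _ (((v L)^-1)%:E * (1 - n%:R * v L / (256 * B))%:E)%E).
        by rewrite lee_pmul2l ?HN// lte_fin invr_gt0.
      rewrite -EFinM lee_fin mulrBr mulr1.
      have -> : (v L)^-1 * (n%:R * v L / (256 * B)) = n%:R / (256 * B).
        by field; rewrite !gt_eqF.
      by rewrite lerD2r invf_le1 ?speed_ge1.
    move=> /(le_trans hl); rewrite leeNl => h.
    rewrite -[leLHS]oppeK -EFinN opprB; apply: le_trans h _.
    by apply: ereal_inf_lbound; exists f.
  apply: eq_infty => r.
  pose n := (Num.truncn ((`|r| + 1) * (256 * B))).+1.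
  apply: le_trans (low n isT); rewrite lee_fin.
  have : (`|r| + 1) * (256 * B) < n%:R by exact: truncnS_gt.
  rewrite -ltr_pdivlMr ?mulr_gt0//; have := ler_norm r; lra.
have [b [N [b0 HN]]] := increment_lower.
have := ub C (Cclosed_osc x0 y0).
have -> : (- ereal_inf (I @` C) = -oo)%E.
  rewrite (_ : ereal_inf _ = +oo)%E//; apply/eqP; rewrite eq_le leey/=.
  by apply/ereal_infP => _ [f /Iinf -> <-].
rewrite leeNy_eq => /eqP h.
(* The upper bound on [C] is now minus infinity, so any finite lower bound for this upper limit
   gives the contradiction. *)
suff : ((- (45 / b))%:E <= limn_esup (fun L => ((v L)^-1)%:E * elog (P [set w | C (X L w)])))%E.
  by rewrite h leeNy_eq.
apply: (limn_esup_ge _ _ N) => L NL.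
have -> : [set w | C (X L w)] = [set w | 1 <= `|T L w x0 - T L w y0|].
  apply/seteqP; split => w /=; first by move=> []; rewrite XT.
  by move=> hw; split; [exact: Xc|rewrite XT].
apply: (@le_trans _ _ (((v L)^-1)%:E * (- (45 / b * v L))%:E)%E); last first.
  by rewrite lee_pmul2l ?HN// lte_fin invr_gt0.
rewrite -EFinM lee_fin mulrN lerN2 [leLHS]mulrC mulfK// gt_eqF//.
Qed.

End no_LDP.

(* Index convention: T L is the field T_{L+1}, L : nat, so L ranges over L >= 1. *)
Theorem theorem4p2 (R : realType) (d : nat) (J : nat -> R) (c rho : R)
  (d0 : measure_display) (Omega : measurableType d0)
  (P : probability Omega R) (T : nat -> Omega -> sph R d -> R) :
  (0 < d)%N ->
  (forall n, exists2 q, (n <= q)%N & J q != 0) ->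
  cvgn (series (fun q => `|J q.+1| / (q`!)%:R)) ->
  kappa J 1 = 1 ->
  (fun t => (kappa J 1 - kappa J t) / (1 - t)) @ (1:R)^'- --> (1:R) ->
  c != 0 -> 1 < rho ->
  (fun t => (1 - kappa J t - (1 - t) + c * (1 - t) `^ rho) / (1 - t) `^ rho)
     @ (1:R)^'- --> (0:R) ->
  (forall L, centered_gaussian_field P (T L)
               (fun x y => iter L.+1 (kappa J) (dot (val x) (val y)))) ->
  (forall L w, sph_continuous (T L w)) ->
  let v := fun L : nat => (L.+1)%:R `^ (rho - 1)^-1 in
  ~ LDP P (fun L w x => T L w x - T L w (north R d)) v /\
  ~ LDP P (fun L w x => T L w x - sph_avg (T L w)) v.
Proof.
move=> d_gt0 _ _ k1 klim c0 rho1 kexp gT Tc v.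
have shift_cont (f : sph R d -> R) a : sph_continuous f ->
    sph_continuous (fun x => f x - a).
  move=> fc x e /(fc x)[del del0 H]; exists del => // y /H.
  by rewrite opprB addrA subrK.
split; apply: (no_LDP_of_increments d_gt0 k1 klim c0 rho1 kexp gT) => L w; try exact: shift_cont.
  by move=> x y; ring.
by move=> x y; ring.
Qed.
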